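(* An Arnoux--Rauzy word over an alphabet of at most $3$ letters is uniformly factor-balanced if and only if it has bounded weak partial quotients.
   Context: Let $\mathcal{A}$ be a finite alphabet with $d=|\mathcal{A}|\ge 2$. For $a\in\mathcal{A}$, the Arnoux--Rauzy substitution $\sigma_a\colon\mathcal{A}^*\to\mathcal{A}^*$ maps $a\mapsto a$ and $b\mapsto ba$ for $b\ne a$. An infinite word $\mathbf{x}$ over $\mathcal{A}$ is Arnoux--Rauzy if it is recurrent, has exactly $(d-1)n+1$ factors of length $n$ for each $n$, and has exactly one left special and one right special factor of each length; equivalently, its set of factors coincides with that of $\lim_{n\to\infty}\sigma_{a_0}\circ\sigma_{a_1}\circ\cdots\circ\sigma_{a_n}(a)$ for some letter $a$ and a sequence $(a_n)_{n\ge0}$ of letters (its directive sequence) in which every letter of $\mathcal{A}$ occurs infinitely often. Writing $a_0a_1a_2\cdots=b_0^{k_0}b_1^{k_1}b_2^{k_2}\cdots$ with $b_n\ne b_{n+1}$ and $k_n\ge1$, the sequence $(k_n)_{n\ge0}$ is the sequence of weak partial quotients; the word has bounded weak partial quotients if this sequence is bounded. For a finite word $w$, $|u|_w$ is the number of (possibly overlapping) occurrences of $w$ in $u$. An infinite word $\mathbf{x}$ is uniformly factor-balanced if there is $C>0$ such that $\big||u|_w-|v|_w\big|\le C$ for every finite word $w$ and all factors $u,v$ of $\mathbf{x}$ with $|u|=|v|$. *)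

(* Defs.v *)
From mathcomp Require Import all_boot all_algebra.
From mathcomp Require Import boolp.

Set Implicit Arguments.
Unset Strict Implicit.
Unset Printing Implicit Defensive.

Local Open Scope nat_scope.

(* Finite words over A are of type seq A, infinite words of type nat -> A. *)

Definition window (A : Type) (x : nat -> A) (i n : nat) : seq A :=
  mkseq (fun j => x (i + j)) n.

Definition factor (A : Type) (x : nat -> A) (w : seq A) : Prop :=
  exists i, window x i (size w) = w.

Definition recurrent (A : Type) (x : nat -> A) : Prop :=
  forall w, factor x w -> forall n, exists2 i, n <= i & window x i (size w) = w.

Definition left_special (A : Type) (x : nat -> A) (w : seq A) : Prop :=
  exists a b, [/\ a <> b, factor x (a :: w) & factor x (b :: w)].

Definition right_special (A : Type) (x : nat -> A) (w : seq A) : Prop :=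
  exists a b, [/\ a <> b, factor x (rcons w a) & factor x (rcons w b)].

Definition arnoux_rauzy (A : finType) (x : nat -> A) : Prop :=
  [/\ recurrent x,
      forall n, #|[set w : n.-tuple A | `[< factor x w >]]| = (#|A| - 1) * n + 1,
      forall n, exists! w, size w = n /\ left_special x w
    & forall n, exists! w, size w = n /\ right_special x w].

(* The Arnoux-Rauzy substitution sigma_a: a |-> a, and b |-> ba for b <> a. *)
Definition ar_subst (A : eqType) (a : A) (u : seq A) : seq A :=
  flatten [seq (if b == a then [:: a] else [:: b; a]) | b <- u].

(* sigma_(a 0) o sigma_(a 1) o ... o sigma_(a n) *)
Definition ar_subst_comp (A : eqType) (a : nat -> A) (n : nat) (u : seq A) :
    seq A :=
  foldr (@ar_subst A) u (mkseq a n.+1).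

Definition word_lim (A : eqType) (u : nat -> seq A) (y : nat -> A) : Prop :=
  forall m, exists N, forall n, N <= n -> prefix (mkseq y m) (u n).

Definition directive_sequence (A : eqType) (x a : nat -> A) : Prop :=
  (forall b n, exists2 m, n <= m & a m = b) /\
  exists c y, word_lim (fun n => ar_subst_comp a n [:: c]) y /\
              forall w, factor x w <-> factor y w.

(* a 0, a 1, ... is the infinite product of the blocks (b n)^(k n), n >= 0. *)
Definition weak_partial_quotients (A : eqType) (a : nat -> A) (k : nat -> nat) :
    Prop :=
  exists b : nat -> A,
    [/\ forall n, b n != b n.+1,
        forall n, 1 <= k n
      & word_lim (fun n => flatten (mkseq (fun m => nseq (k m) (b m)) n)) a].

(* An Arnoux-Rauzy word has a unique directive sequence, which has a unique
   sequence of weak partial quotients, so that exists just names them here. *)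
Definition bounded_weak_partial_quotients (A : eqType) (x : nat -> A) : Prop :=
  exists a k, [/\ directive_sequence x a, weak_partial_quotients a k
                & exists K, forall n, k n <= K].

(* |u|_w, overlapping occurrences included. *)
Definition occurrences (A : eqType) (w u : seq A) : nat :=
  count (fun i => prefix w (drop i u)) (iota 0 (size u).+1).

Definition uniformly_factor_balanced (A : eqType) (x : nat -> A) : Prop :=
  exists2 C : nat, 0 < C &
    forall w u v : seq A, factor x u -> factor x v -> size u = size v ->
      `|occurrences w u - occurrences w v|%N <= C.

(* Main.v *)
Require Import Defs.
From mathcomp Require Import all_boot all_algebra.
From mathcomp Require Import all_order boolp zify.
Import Order.TTheory GRing.Theory Num.Theory.

Set Implicit Arguments.
Unset Strict Implicit.
Unset Printing Implicit Defensive.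

Local Open Scope nat_scope.

(* After replacing x by the limit word Y 0 of its directive sequence, an
   occurrence of any factor w extends to an occurrence of a bispecial word, and
   these are exactly the cutting points of the decomposition of Y 0 into images
   of letters under m = m(w) substitutions. So uniform factor-balance is the
   uniform balance of the m-cutting points.

   If a letter is repeated 2j times in the directive sequence, then at the middle
   of the run the image of another letter is at least as long as j images of that
   letter, and windows of this length contain j or at most 1 cutting points.

   Conversely, if runs have length at most K, the image lengths satisfy the
   triangle inequality and so have ratios at most K + 2; it remains to bound the
   letter imbalance. For two windows of the same length, the vector delta of
   differences of letter counts evolves under desubstitution by
   delta_a <- delta_a - (sum of the others) + O(1), all levels staying close to
   the plane orthogonal to the image lengths. Where the maximum D of |delta| over
   all levels is attained, say delta_b = -D, the next occurrence of b would exceed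
   D unless delta is close to (-D, -D, D); then the next occurrence of the third
   letter exceeds D, if D is large. *)

(** * Words and desubstitution *)

Section Words.
Variable A : eqType.
Implicit Types (a b e : A) (u v w z : seq A).

Lemma ar_subst_cons a b w :
  ar_subst a (b :: w) =
  (if b == a then [:: a] else [:: b; a]) ++ ar_subst a w.
Proof. by []. Qed.

Lemma ar_subst_cat a u v :
  ar_subst a (u ++ v) = ar_subst a u ++ ar_subst a v.
Proof. by rewrite /ar_subst map_cat flatten_cat. Qed.

Lemma last_ar_subst a w : last a (ar_subst a w) = a.
Proof.
elim: w => [//|b w IH]; rewrite ar_subst_cons last_cat.
by case: eqP => _ /=.
Qed.

Lemma cons_ar_subst a w :
  exists t, a :: ar_subst a w = rcons t a.
Proof.
exists (belast a (ar_subst a w)).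
by rewrite -[X in rcons _ X](last_ar_subst a w) -lastI.
Qed.

Lemma rev_cons_ar_subst a w :
  rev (a :: ar_subst a w) = a :: ar_subst a (rev w).
Proof.
elim: w => [//|b w IH]; rewrite ar_subst_cons [rev (b :: w)]rev_cons -cats1.
rewrite ar_subst_cat -[in RHS]cat_cons -IH.
case: (eqVneq b a) => [->|nba]; rewrite /= /ar_subst /= ?eqxx ?(negbTE nba) /=.
  by rewrite !rev_cons -!cats1.
by rewrite !rev_cons -!cats1 -!catA.
Qed.

(** Reads off the blocks [a] and [b a] from the left. The letter after [b] is skipped unseen, as
    [valid] checks that it is [a]; a final [b] counts as a block whose [a] is cut off. *)
Fixpoint desub a w :=
  match w with
  | [::] => [::]
  | b :: r => if b == a then a :: desub a r else
      match r with [::] => [:: b] | _ :: r' => b :: desub a r' end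
  end.

Fixpoint valid a w :=
  match w with
  | [::] => true
  | b :: r => if b == a then valid a r else
      match r with [::] => true | e :: r' => (e == a) && valid a r' end
  end.

Lemma desub_ind a (P : seq A -> Prop) :
  P [::] -> (forall r, P r -> P (a :: r)) ->
  (forall b, b != a -> P [:: b]) ->
  (forall b e r, b != a -> P r -> P [:: b, e & r]) ->
  forall w, P w.
Proof.
move=> P0 Pa P1 P2 w; have [n] := ubnP (size w); elim: n w => // n IH [//|b r] /=.
rewrite ltnS => sz; have [->|nba] := eqVneq b a; first by apply: Pa; apply: IH.
by case: r sz => [|e r] /= sz; [apply: P1|apply: P2 => //; apply: IH; lia].
Qed.

Lemma valid_cat a w v : valid a (ar_subst a w ++ v) = valid a v.
Proof.
elim: w => [//|b w IH]; rewrite ar_subst_cons.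
by case E: (b == a) => /=; rewrite ?E ?eqxx.
Qed.

Lemma desub_cat a w v : desub a (ar_subst a w ++ v) = w ++ desub a v.
Proof.
elim: w => [//|b w IH]; rewrite ar_subst_cons.
by case E: (b == a) => /=; rewrite ?E ?eqxx ?(eqP E) IH.
Qed.

Lemma desub_subst a w : desub a (ar_subst a w) = w.
Proof. by rewrite -[ar_subst a w]cats0 desub_cat cats0. Qed.

Lemma valid_subst a w : valid a (ar_subst a w).
Proof. by rewrite -[ar_subst a w]cats0 valid_cat. Qed.

Lemma ar_subst_inj a : injective (ar_subst a).
Proof. exact: can_inj (desub_subst a). Qed.

Lemma subst_desub a u :
  valid a u -> ar_subst a (desub a u) = if last a u == a then u else rcons u a.
Proof.
elim/(@desub_ind a): u => [|r IH|b nb|b e r nb IH] /=; rewrite ?eqxx //.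
- move=> /IH; rewrite ar_subst_cons eqxx => ->.
  by case: eqP.
- by rewrite !(negbTE nb) /ar_subst /= (negbTE nb).
rewrite (negbTE nb) => /andP[/eqP -> /IH].
rewrite ar_subst_cons (negbTE nb) => ->.
by case: eqP.
Qed.

Lemma prefix_subst_desub a u :
  valid a u -> exists t, ar_subst a (desub a u) = u ++ t.
Proof.
move=> /subst_desub ->; case: eqP => _; first by exists [::]; rewrite cats0.
by exists [:: a]; rewrite cats1.
Qed.

Lemma size_desub a u : size (desub a u) <= size u.
Proof.
elim/(@desub_ind a): u => [|r IH|b nb|b e r nb IH] //=; rewrite ?eqxx //=.
  by rewrite (negbTE nb).
by rewrite (negbTE nb) /=; lia.
Qed.

Lemma size_desub_ge a u : size u <= (size (desub a u)).*2.
Proof.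
elim/(@desub_ind a): u => [|r IH|b nb|b e r nb IH] //=; rewrite ?eqxx //=.
- by lia.
- by rewrite (negbTE nb).
by rewrite (negbTE nb) /=; lia.
Qed.

(** A leading [a] may be a block of its own or the end of a block [b a]. As every [a] ends a block,
    the rest [strip a w] starts one in either case. *)
Definition hd a w := if w is b :: _ then if b == a then [:: a] else [::] else [::].
Definition strip a w :=
  if w is b :: r then if b == a then r else w else [::].

Lemma hd_strip a w : w = hd a w ++ strip a w.
Proof. by case: w => //= b r; case: eqP => [->|]. Qed.

Lemma size_desub_strip a w :
  1 < size w -> size (desub a (strip a w)) < size w.
Proof.
case: w => [//|b [//|e r]] _ /=; have [|nb] := eqVneq b a.
  by have := size_desub a (e :: r); rewrite /=; lia.
by rewrite /= (negbTE nb) /=; have := size_desub a r; lia.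
Qed.

Definition occ (x : nat -> A) p w := window x p (size w) = w.

Lemma window_cons (x : nat -> A) p n : window x p n.+1 = x p :: window x p.+1 n.
Proof.
rewrite /window /mkseq /= addn0; congr cons.
rewrite (iotaDl 1 0) -map_comp; apply: eq_map => j /=.
by rewrite addnS addSn.
Qed.

Lemma window_cat (x : nat -> A) p n m :
  window x p (n + m) = window x p n ++ window x (p + n) m.
Proof.
elim: n p => [|n IH] p; first by rewrite addn0.
by rewrite addSn !window_cons IH addSnnS.
Qed.

Lemma size_window (x : nat -> A) p n : size (window x p n) = n.
Proof. exact: size_mkseq. Qed.

Lemma occ_window (x : nat -> A) p n : occ x p (window x p n).
Proof. by rewrite /occ size_window. Qed.

Lemma occ_cons x p b w : occ x p (b :: w) <-> x p = b /\ occ x p.+1 w.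
Proof.
by rewrite /occ /= window_cons; split => [[-> ->]|[-> ->]].
Qed.

Lemma occ_cat x p u v : occ x p (u ++ v) <-> occ x p u /\ occ x (p + size u) v.
Proof.
elim: u p => [|b u IH] p /=; first by rewrite addn0; split => // -[].
rewrite !occ_cons IH addSnnS; tauto.
Qed.

Lemma occ_nth x p w x0 i : occ x p w -> i < size w -> x (p + i) = nth x0 w i.
Proof. by move=> <- ; rewrite size_window => lt; rewrite nth_mkseq. Qed.

End Words.

(** * Image lengths and letter imbalances *)

Section Weights.
Variables (A : eqType) (a : nat -> A).

(** The length of the image of [b] under the first [n] substitutions. *)
Fixpoint wt n b : nat :=
  if n is m.+1 then wt m b + (b != a m) * wt m (a m) else 1.

Definition run_bound K := forall n, exists2 i, i <= K & a (n + i) <> a n.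

Lemma wt_gt0 n b : 0 < wt n b.
Proof. by elim: n => //= n IH; lia. Qed.

Lemma wt_mono n m b : n <= m -> wt n b <= wt m b.
Proof. by elim: m => [|m IH]; [case: n|rewrite leq_eqVlt => /predU1P[->|/IH] //=; lia]. Qed.

(** A step adds the weight of [a n] to every letter but [a n], so at least one of [c], [e] gains it
    whenever [b] does. *)
Lemma wt_triangle n b c e :
  b <> c -> b <> e -> c <> e -> wt n b <= wt n c + wt n e.
Proof.
elim: n b c e => [//|n IH] b c e bc be ce /=.
have := IH _ _ _ bc be ce.
have [<-|] := eqVneq b (a n); first by lia.
have [<-|ca] := eqVneq c (a n).
  have -> : e != c by apply/eqP => h; apply: ce.
  by lia.
by case: eqVneq => [<-|ea]; lia.
Qed.

Lemma wt_ratio K (b0 c0 : A) (hbc : b0 <> c0) n b c :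
  run_bound K -> wt n b <= K.+2 * wt n c.
Proof.
move=> hK.
(* Invariant: [u] is lightest and has been the directive letter since step [s]; each such step adds
   one weight of [u] to [v]. When another letter comes, it becomes lightest and the old [u] takes
   the place of [v]. *)
have: exists u v s, [/\ u <> v, forall i, wt n u <= wt n i, s <= n,
   forall i, s <= i < n -> a i = u & wt n v <= (n - s).+1 * wt n u].
  elim: n => [|n [u [v [s [uv umin sn su hv]]]]].
    by exists b0, c0, 0; split => // i; rewrite andbC.
  have [eau|nau] := eqVneq (a n) u.
    exists u, v, s; split => //=; first 2 last.
    - by move=> i /andP[si]; rewrite ltnS leq_eqVlt => /predU1P[->//|lt]; apply: su; rewrite si.
    - by rewrite eau eqxx; case: eqP uv => [->//|_ _]; rewrite subSn //=; nia.
    - by move=> i; rewrite eau eqxx /=; have := umin i; lia.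
    by lia.
  exists (a n), u, n; split => //=; first by move/eqP: nau.
  - move=> i; rewrite eqxx; have [->|_] := eqVneq i (a n); first by lia.
    by have := umin i; lia.
  - by move=> i; rewrite ltnS -eqn_leq => /eqP ->.
  - by rewrite eqxx subSnn eq_sym nau; have := umin (a n); lia.
move=> [u [v [s [uv umin sn su hv]]]].
have hr : n - s <= K.
  have [i iK ni] := hK s; rewrite leqNgt; apply/negP => lt; apply: ni.
  by rewrite !su //; lia.
have hv' : wt n v <= K.+1 * wt n u by nia.
suff : wt n b <= K.+2 * wt n u by have := umin c; nia.
have [->|nbu] := eqVneq b u; first by nia.
have [->|nbv] := eqVneq b v; first by nia.
by have := wt_triangle n (elimN eqP nbu) (elimN eqP nbv) uv; nia.
Qed.

End Weights.

Section Dynamics.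
Local Open Scope ring_scope.

Lemma sum_I3 (R : nmodType) (F : 'I_3 -> R) (b c e : 'I_3) :
  b <> c -> b <> e -> c <> e -> \sum_i F i = F b + F c + F e.
Proof.
move=> bc be ce; rewrite (bigD1 b) //= (bigD1 c) /=; last by apply/eqP => h; apply: bc.
rewrite (bigD1 e) /= ?big1 ?addr0 ?addrA //.
  case: b c e bc be ce => [[|[|[|?]]] ?] [[|[|[|?]]] ?] [[|[|[|?]]] ?] //= bc be ce;
  case=> [[|[|[|?]]] ?] //=; by [case: bc; apply: val_inj|case: be; apply: val_inj|case: ce; apply: val_inj].
by apply/andP; split; apply/eqP => h; [apply: be|apply: ce].
Qed.

Lemma other_I3 (b : 'I_3) : exists c e, [/\ b <> c, b <> e & c <> e].
Proof.
case: b => [[|[|[|?]]] h] //.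
- by exists (inord 1), (inord 2); split => /(congr1 val); rewrite /= ?inordK.
- by exists (inord 0), (inord 2); split => /(congr1 val); rewrite /= ?inordK.
- by exists (inord 0), (inord 1); split => /(congr1 val); rewrite /= ?inordK.
Qed.

Lemma cases_I3 (b c e : 'I_3) :
  b <> c -> b <> e -> c <> e -> forall i, i = b \/ i = c \/ i = e.
Proof.
move=> bc be ce i; have [|ib] := eqVneq i b; first by left.
have [|ic] := eqVneq i c; first by right; left.
have [|ie] := eqVneq i e; first by right; right.
exfalso; move: bc be ce ib ic ie.
by case: b c e i => [[|[|[|?]]] ?] [[|[|[|?]]] ?] [[|[|[|?]]] ?] [[|[|[|?]]] ?] //= bc be ce;
  by [case: bc; apply: val_inj|case: be; apply: val_inj|case: ce; apply: val_inj].
Qed.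

Variables (a : nat -> 'I_3) (delta : nat -> 'I_3 -> int).

(** [delta n b] stands for the difference of the numbers of [b] in two windows, read at level [n].
    Every image holds one [a n], so this letter counts the letters of level [n + 1]; the four window
    ends cost at most 2. *)
Definition imbalance :=
  [/\ forall n b, b <> a n -> delta n.+1 b = delta n b,
      forall n, `|delta n (a n) - \sum_b delta n.+1 b| <= 2
    & \sum_b delta 0%N b = 0].

Hypothesis hdelta : imbalance.

Notation g := (wt a).

(** The weighted sum compares the image lengths of the two windows. A step changes it by at most
    twice the weight of [a n], and one of [c], [e] gains this weight. *)
Lemma weighted_imbalance n c e : c <> e ->
  `|\sum_b (g n b)%:Z * delta n b| <= 2 * ((g n c)%:Z + (g n e)%:Z).
Proof.
have [hn ha h0] := hdelta.
elim: n c e => [|n IH] c e ce.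
  rewrite (eq_bigr (delta 0)) ?h0 //= => i _.
  by rewrite mul1r.
have [c' [e' [ac ae ce']]] := other_I3 (a n).
have := IH _ _ ce; have := ha n.
rewrite !(sum_I3 _ ac ae ce') /= eqxx.
have -> : (c' != a n) = true by apply/eqP => h; apply: ac.
have -> : (e' != a n) = true by apply/eqP => h; apply: ae.
rewrite (hn n c' (nesym ac)) (hn n e' (nesym ae)).
have gp := wt_gt0 a n (a n).
have hce : (g n (a n) <= (c != a n) * g n (a n) + (e != a n) * g n (a n))%N.
  have [eqc|] := eqVneq c (a n); last by lia.
  by have [eqe|] := eqVneq e (a n); [case: ce; rewrite eqc|lia].
move: gp hce; generalize (g n (a n)) (g n c') (g n e') (g n c) (g n e).
generalize (delta n (a n)) (delta n.+1 (a n)) (delta n c') (delta n e').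
move=> d d' dc de ga gc ge gc0 ge0 gp hce h1 h2.
have : - 2 * ga%:Z <= ga%:Z * (d - (d' + dc + de)) <= 2 * ga%:Z by nia.
move: (c != a n) (e != a n) hce => [] [] /= hce; nia.
Qed.

Lemma first_occurrence (b : 'I_3) n :
  (exists2 m, n <= m & a m = b)%N ->
  exists m, [/\ (n <= m)%N, a m = b & forall i, (n <= i < m)%N -> a i <> b].
Proof.
move=> [m0 nm0 am0].
have hex : exists m, (n <= m)%N && (a m == b) by exists m0; rewrite nm0 am0 eqxx.
case: (ex_minnP hex) => m /andP[nm /eqP am] hmin.
exists m; split => // i /andP[ni im] ai.
by have := hmin i; rewrite ni ai eqxx => /(_ isT); rewrite leqNgt im.
Qed.

Lemma imbalance_const (b : 'I_3) n m :
  (n <= m)%N -> (forall i, (n <= i < m)%N -> a i <> b) -> delta m b = delta n b.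
Proof.
have [hn _ _] := hdelta.
elim: m => [|m IH]; first by case: n.
rewrite leq_eqVlt => /predU1P[->//|nm] h.
rewrite hn; last by apply/nesym/h; rewrite -ltnS nm ltnSn.
by apply: IH => // i /andP[ni im]; apply: h; rewrite ni ltnW.
Qed.

(** A step with letter [b] or [c] adds the same weight to [e] and to exactly one of [b], [c]. *)
Lemma wt_defect_const (b c e : 'I_3) n m :
  b <> c -> b <> e -> c <> e ->
  (n <= m)%N -> (forall i, (n <= i < m)%N -> a i <> e) ->
  (g m b)%:Z + (g m c)%:Z - (g m e)%:Z = (g n b)%:Z + (g n c)%:Z - (g n e)%:Z.
Proof.
move=> bc be ce; elim: m => [|m IH]; first by case: n.
rewrite leq_eqVlt => /predU1P[->//|nm] h.
rewrite -IH //; last by move=> i /andP[ni im]; apply: h; rewrite ni ltnW.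
have hm : a m <> e by apply: h; rewrite -ltnS nm ltnSn.
rewrite /=; have -> : (e != a m) = true by apply/eqP => he; apply: hm.
have [hb|[hc|//]] := cases_I3 bc be ce (a m).
  rewrite hb eqxx; have -> : (c != b) = true by apply/eqP => h'; apply: bc.
  by lia.
rewrite hc eqxx; have -> : (b != c) = true by apply/eqP.
by lia.
Qed.

Variables (K D : nat).
Hypothesis hK : run_bound a K.
Hypothesis hD : forall n b, `|delta n b| <= D%:Z.
Hypothesis hocc : forall b, (forall n, exists2 m, n <= m & a m = b)%N \/
  forall n, delta n b = 0.

(** [R] bounds the ratio of two weights, and [E] the distance from the plane in units of any weight.
    [F] and [F'] measure how close the imbalance comes to (-D, -D, D). *)
Let R : int := K.+2%:Z.
Let E : int := 4 * R.
Let F : int := 2 * R + E.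
Let F' : int := R * F + E.

(** The imbalance is (da, -D, dc). As [dc <= 2 - da] and [gc <= ga + gb], closeness to the plane
    forces [da] near -D, and then [dc] near D. Since [dc] is at most D, the triangle inequality is
    then almost an equality. *)
Lemma first_return (ga gb gc da dc : int) :
  0 < ga -> 0 < gb -> 0 < gc -> ga <= R * gb -> gc <= R * gb -> ga <= R * gc ->
  gc <= ga + gb ->
  `|ga * da - gb * D%:Z + gc * dc| <= E * gb ->
  `|ga * da - gb * D%:Z + gc * dc| <= E * gc ->
  E + 2 * R < D%:Z -> - D%:Z <= da <= D%:Z -> - D%:Z <= dc <= D%:Z ->
  da + dc <= 2 -> da < 0 ->
  [/\ da <= F - D%:Z, D%:Z - F' <= dc &
   (ga + gb - gc) * D%:Z <= F * ga + E * gb].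
Proof.
move=> ga0 gb0 gc0 gab gcb gac tri he1 he2 hD1 hda hdc hs hneg.
have F0 : 0 <= F by rewrite /F /E /R; lia.
have eF : F = 2 * R + E by [].
have eF' : F' = R * F + E by [].
move: R E F F' F0 eF eF' he1 he2 hD1 gab gcb gac => r e f f' f0 ef ef' he1 he2 hD1 gab gcb gac.
have h1 : da <= f - D%:Z.
  rewrite -(ler_pM2l gb0).
  have t1 : 0 <= gc * (2 - da - dc) by apply: mulr_ge0; lia.
  have t2 : 0 <= (ga + gb - gc) * (- da) by apply: mulr_ge0; lia.
  by rewrite ef; lia.
have t1 : 0 <= ga * (f - D%:Z - da) by apply: mulr_ge0; lia.
split => //.
  rewrite -(ler_pM2l gc0).
  have t2 : 0 <= (ga + gb - gc) * D%:Z by apply: mulr_ge0; lia.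
  have t3 : 0 <= (r * gc - ga) * f by apply: mulr_ge0; lia.
  by rewrite ef'; lia.
have t2 : 0 <= gc * (D%:Z - dc) by apply: mulr_ge0; lia.
by lia.
Qed.

(** If [da > 0], then [ga * da + gb * db] is at least [- gb * D], while the small defect makes
    [gc * dc] at least about [(ga + gb) * D]; the plane is missed by about [ga * D]. Otherwise [da]
    and [db] are at most 0 and too small in sum to balance [dc]. *)
Lemma second_return (ga gb gc da db dc : int) :
  0 < ga -> 0 < gb -> 0 < gc ->
  ga <= R * gc -> gb <= R * gc -> gc <= R * ga -> gb <= R * ga ->
  `|ga * da + gb * db + gc * dc| <= E * gc ->
  `|ga * da + gb * db + gc * dc| <= E * ga ->
  - D%:Z <= da <= D%:Z -> - D%:Z <= db <= D%:Z ->
  D%:Z - F' <= dc -> - (da + db) <= F' + 2 ->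
  (ga + gb - gc) * D%:Z <= F * ga + F * gb + E * ga + E * gb ->
  db <= da ->
  D%:Z <= R * F + F + R * E + E + E + (R + 1) * (F' + 2).
Proof.
move=> ga0 gb0 gc0 gac gbc gca gba he1 he2 hda hdb hdc hs hdef hle.
have R0 : 0 <= R by [].
have E0 : 0 <= E by rewrite /E /R; lia.
have F0 : 0 <= F by rewrite /F /E /R; lia.
have eF' : F' = R * F + E by [].
have F'0 : 0 <= F' by rewrite eF'; apply: addr_ge0 => //; apply: mulr_ge0.
move: R E F F' R0 E0 F0 F'0 eF' gac gbc gca gba hdc hs he1 he2 hdef.
move=> r e f f' r0 e0 f0 f0' ef' gac gbc gca gba hdc hs he1 he2 hdef.
have rf : 0 <= r * f by apply: mulr_ge0.
have re : 0 <= r * e by apply: mulr_ge0.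
have rf' : 0 <= r * f' by apply: mulr_ge0.
have [da0|da0] := ltrP 0 da.
  rewrite -(ler_pM2l ga0).
  have t1 : 0 <= gb * (D%:Z + db) by apply: mulr_ge0; lia.
  have t2 : 0 <= ga * da by apply: mulr_ge0; lia.
  have t3 : 0 <= gc * (dc - D%:Z + f') by apply: mulr_ge0; lia.
  have t4 : 0 <= (r * ga - gc) * f' by apply: mulr_ge0; lia.
  have t5 : 0 <= (r * ga - gb) * f by apply: mulr_ge0; lia.
  have t6 : 0 <= (r * ga - gb) * e by apply: mulr_ge0; lia.
  have t7 : 0 <= ga * f' by apply: mulr_ge0; lia.
  have t8 : 0 <= ga * r by apply: mulr_ge0; lia.
  by lia.
rewrite -(ler_pM2l gc0).
have t1 : 0 <= gc * (dc - D%:Z + f') by apply: mulr_ge0; lia.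
have t2 : 0 <= (r * gc - ga) * (- da) by apply: mulr_ge0; lia.
have t3 : 0 <= (r * gc - gb) * (- db) by apply: mulr_ge0; lia.
have t4 : 0 <= r * gc * (f' + 2 + da + db) by apply: mulr_ge0; [apply: mulr_ge0|]; lia.
have t5 : 0 <= gc * (r * f) by apply: mulr_ge0; lia.
have t6 : 0 <= gc * (r * e) by apply: mulr_ge0; lia.
have t7 : 0 <= gc * e by apply: mulr_ge0; lia.
have t8 : 0 <= gc * f by apply: mulr_ge0; lia.
by lia.
Qed.

Lemma ratio_I3 n b c : (g n b)%:Z <= R * (g n c)%:Z.
Proof.
have [x [y [xy _ _]]] := other_I3 0.
by have := wt_ratio xy n b c hK; rewrite /R; lia.
Qed.

Lemma near_plane n i b c e : b <> c -> b <> e -> c <> e ->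
  `|(g n b)%:Z * delta n b + (g n c)%:Z * delta n c + (g n e)%:Z * delta n e|
    <= E * (g n i)%:Z.
Proof.
move=> bc be ce; rewrite -(sum_I3 (fun i => (g n i)%:Z * delta n i) bc be ce).
apply: le_trans (weighted_imbalance n ce) _.
have := ratio_I3 n c i; have := ratio_I3 n e i; rewrite /E; lia.
Qed.

Definition balance_bound : int :=
  R * F + F + R * E + E + E + (R + 1) * (F' + 2).

Lemma peak_bound_neg n b c e : b <> c -> b <> e -> c <> e ->
  delta n b = - D%:Z -> a n = b -> delta n c < 0 ->
  delta n c + delta n e <= 2 -> D%:Z <= balance_bound.
Proof.
move=> bc be ce db an dc dce; rewrite leNgt; apply/negP => Dbig.
have F0 : 0 <= F' by rewrite /F' /F /E /R; lia.
have E2R : E + 2 * R < D%:Z by move: Dbig; rewrite /balance_bound /F' /F /E /R; lia.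
have gt0 m i : 0 < (g m i)%:Z by have := wt_gt0 a m i; lia.
have bnd m i : - D%:Z <= delta m i <= D%:Z by rewrite -ler_norml.
have [] : [/\ delta n c <= F - D%:Z, D%:Z - F' <= delta n e &
   ((g n c)%:Z + (g n b)%:Z - (g n e)%:Z) * D%:Z <= F * (g n c)%:Z + E * (g n b)%:Z].
  have pl i : `|(g n c)%:Z * delta n c - (g n b)%:Z * D%:Z + (g n e)%:Z * delta n e|
      <= E * (g n i)%:Z.
    by have := near_plane n i (nesym bc) ce be; rewrite db mulrN.
  apply: first_return => //; try exact: ratio_I3.
  by have := wt_triangle a n (nesym be) (nesym ce) bc; lia.
move=> hc he hdef.
(* An imbalance of [e] that vanishes at all levels would contradict [he], so [e] recurs; until then
   its imbalance stays near D. *)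
have [m [nm am hm]] : exists m, [/\ (n <= m)%N, a m = e & forall i, (n <= i < m)%N -> a i <> e].
  apply: first_occurrence; have [|h0] := hocc e; first by apply.
  move: he Dbig; rewrite h0 /balance_bound /F' /F /E /R; lia.
have de := imbalance_const nm hm.
have hdef2 := wt_defect_const (nesym bc) ce be nm hm.
have [hn ha _] := hdelta.
have ham := ha m; rewrite am (sum_I3 _ bc be ce) in ham.
rewrite (hn m b) ?(hn m c) ?am // in ham.
(* Otherwise the imbalance of [e], at least D - F' at level [m], would exceed D at level [m.+1]. *)
have hs : - (delta m c + delta m b) <= F' + 2.
  have := bnd m.+1 e; lia.
have hw : ((g m c)%:Z + (g m b)%:Z - (g m e)%:Z) * D%:Z <=
     F * (g m c)%:Z + F * (g m b)%:Z + E * (g m c)%:Z + E * (g m b)%:Z.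
  rewrite hdef2; apply: le_trans hdef _.
  have m1 := wt_mono a c nm; have m2 := wt_mono a b nm.
  have := gt0 m c; have := gt0 m b; rewrite /F /E /R; nia.
move: Dbig; apply/negP; rewrite -leNgt.
rewrite -de in he.
have [le|/ltW le] := lerP (delta m b) (delta m c).
  apply: (@second_return (g m c)%:Z (g m b)%:Z (g m e)%:Z _ _ _ _ _ _ _ _ _ _ _ _
    (bnd m c) (bnd m b) he hs hw le); try exact: ratio_I3; try exact: gt0;
    exact: (near_plane _ _ (nesym bc) ce be).
apply: (@second_return (g m b)%:Z (g m c)%:Z (g m e)%:Z _ _ _ _ _ _ _ _ _ _ _ _
    (bnd m b) (bnd m c) he _ _ le); try exact: ratio_I3; try exact: gt0;
    try exact: (near_plane _ _ bc be ce).
- by rewrite addrC.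
- by move: hw; rewrite (addrC (g m b)%:Z) => hw; apply: le_trans hw _; lia.
Qed.

Lemma peak_bound n b : delta n b = - D%:Z -> D%:Z <= balance_bound.
Proof.
move=> db; rewrite leNgt; apply/negP => Dbig.
have E2R : E + 2 * R < D%:Z by move: Dbig; rewrite /balance_bound /F' /F /E /R; lia.
have [m [nm am hm]] : exists m, [/\ (n <= m)%N, a m = b & forall i, (n <= i < m)%N -> a i <> b].
  apply: first_occurrence; have [|h0] := hocc b; first by apply.
  by move: db E2R; rewrite h0 /E /R; lia.
rewrite -(imbalance_const nm hm) in db.
have [c [e [bc be ce]]] := other_I3 b.
have [hn ha _] := hdelta.
have ham := ha m; rewrite am (sum_I3 _ bc be ce) in ham.
rewrite (hn m c) ?(hn m e) ?am in ham; try exact: nesym.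
(* Otherwise the imbalance of [b] at level [m.+1] would fall below -D. *)
have hs : delta m c + delta m e <= 2.
  have := hD m.+1 b; lia.
have [c0|c0] := ltrP (delta m c) 0.
  by move: Dbig; apply/negP; rewrite -leNgt; apply: (peak_bound_neg bc be ce db).
have [e0|e0] := ltrP (delta m e) 0.
  move: Dbig; apply/negP; rewrite -leNgt; apply: (peak_bound_neg be bc (nesym ce) db) => //.
  by rewrite addrC.
(* Both other imbalances are now nonnegative with sum at most 2, too little to offset D times the
   weight of [b]. *)
have := near_plane m b bc be ce; rewrite db.
have g0 : 0 < (g m b)%:Z by have := wt_gt0 a m b; lia.
have rc := ratio_I3 m c b; have re := ratio_I3 m e b => hp.
have t1 : 0 <= (R * (g m b)%:Z - (g m c)%:Z) * delta m c by apply: mulr_ge0; lia.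
have t2 : 0 <= (R * (g m b)%:Z - (g m e)%:Z) * delta m e by apply: mulr_ge0; lia.
have t3 : 0 <= R * (g m b)%:Z * (2 - (delta m c + delta m e)) by apply: mulr_ge0; rewrite /R; lia.
have t4 : 0 < (g m b)%:Z * (D%:Z - (E + 2 * R)) by apply: mulr_gt0; lia.
move: R E t1 t2 t3 t4 hp => r ee t1 t2 t3 t4 hp.
lia.
Qed.

End Dynamics.

Section DynamicsBound.
Local Open Scope ring_scope.

Lemma imbalance_opp a delta :
  imbalance a delta -> imbalance a (fun n b => - delta n b).
Proof.
move=> [h1 h2 h3]; split => [n b /h1 -> //|n|]; last by rewrite sumrN h3 oppr0.
by rewrite sumrN -opprD normrN.
Qed.

(** The bound [B] provides a least bound [D], which is attained. Negating [delta] turns the value D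
    into -D. *)
Lemma imbalance_bounded (K B : nat) (a : nat -> 'I_3) (delta : nat -> 'I_3 -> int) :
  imbalance a delta -> run_bound a K ->
  (forall b, (forall n, exists2 m, n <= m & a m = b)%N \/ forall n, delta n b = 0) ->
  (forall n b, `|delta n b| <= B%:Z) ->
  forall n b, `|delta n b| <= balance_bound K.
Proof.
move=> him hK hocc hB.
have hex : exists D : nat, `[< forall n b, `|delta n b| <= D%:Z >].
  by exists B; apply/asboolP.
case: (ex_minnP hex) => D /asboolP hD Dmin n b.
apply: le_trans (hD n b) _.
have : exists n b, `|delta n b| = D%:Z.
  apply: contrapT => /forallNP hno.
  case: D hD Dmin hno => [|D] hD Dmin hno.
    by apply: (hno n); exists b; have := hD n b; lia.
  have : (D.+1 <= D)%N; last by rewrite ltnn.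
  apply: Dmin; apply/asboolP => m c.
  have := hD m c; have : `|delta m c| <> D.+1%:Z by move=> h; apply: (hno m); exists c.
  by lia.
move=> [m [c hmc]].
have [neg|pos] : delta m c = - D%:Z \/ - delta m c = - D%:Z by lia.
  exact: (peak_bound him hK hD hocc neg).
apply: (@peak_bound a (fun n b => - delta n b) (imbalance_opp him) K D hK _ _ m c pos).
  by move=> n' b'; rewrite normrN.
by move=> b'; case: (hocc b') => h; [left|right => k; rewrite h oppr0].
Qed.

End DynamicsBound.

(** * Occurrences and cutting points *)

Section Coding.
Variables (A : eqType) (a : A) (x x' : nat -> A) (C : nat -> nat).

(* x = ar_subst a x', with C q the position where the image of the letter x' q
   starts. *)
Definition coding := C 0 = 0 /\ forall q,
  occ x (C q) (ar_subst a [:: x' q]) /\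
  C q.+1 = C q + size (ar_subst a [:: x' q]).

Hypothesis hC : coding.

Lemma coding_eq q : x' q = a ->
  x (C q) = a /\ C q.+1 = (C q).+1.
Proof.
move=> e; have [_ /(_ q)] := hC.
by rewrite e /ar_subst /= eqxx occ_cons addn1 => -[[]].
Qed.

Lemma coding_neq q : x' q != a ->
  [/\ x (C q) = x' q, x (C q).+1 = a & C q.+1 = (C q).+2].
Proof.
move=> e; have [_ /(_ q)] := hC.
by rewrite /ar_subst /= (negbTE e) !occ_cons addn2 => -[[? []]].
Qed.

Lemma coding_head q : x (C q) = x' q.
Proof.
by have [/[dup] e /coding_eq[-> _]//|/coding_neq[]//] := eqVneq (x' q) a.
Qed.

Lemma coding_lt q : C q < C q.+1.
Proof. by have [/coding_eq[_ ->]|/coding_neq[_ _ ->]] := eqVneq (x' q) a; lia. Qed.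

Lemma coding_ge q : q <= C q.
Proof. by elim: q => // q IH; have := coding_lt q; lia. Qed.

Lemma coding_mono q r : q < r -> C q < C r.
Proof. exact: (homo_ltn ltn_trans coding_lt). Qed.

Lemma coding_occ q u :
  occ x' q u -> occ x (C q) (ar_subst a u) /\ C (q + size u) = C q + size (ar_subst a u).
Proof.
elim: u q => [|b u IH] q /=; first by rewrite !addn0.
rewrite occ_cons => -[<- /IH[o s]].
have [_ /(_ q)[o1 s1]] := hC.
rewrite -cat1s ar_subst_cat occ_cat size_cat -s1; split => //.
by rewrite addnS -addSn s s1 addnA.
Qed.

Lemma coding_pos p : exists q, q <= p /\
  (C q = p \/ [/\ C q = p.+1, x p = a & 0 < q]).
Proof.
have [C0 _] := hC.
elim: p => [|p [q [qp [h|[h xa q0]]]]]; first by exists 0; split => //; left.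
- exists q.+1; have [/coding_eq[_ ->]|/coding_neq[_ xa ->]] := eqVneq (x' q) a.
    by split=> //; left; rewrite h.
  by split=> //; right; rewrite -h.
- by exists q; split; [lia|left].
Qed.

Lemma coding_end q : x (C q.+1).-1 = a.
Proof.
by have [/coding_eq[h ->]|/coding_neq[_ h ->]] := eqVneq (x' q) a.
Qed.

(** Each image ends with [a] and contains no other [a]. *)
Lemma coding_eq_a p : x p = a <-> exists q, C q = p.+1.
Proof.
have [C0 _] := hC; split.
  have [q [_ [h|[h _ _]]]] := coding_pos p; last by exists q.
  rewrite -h coding_head => /coding_eq[_ <-]; by exists q.+1.
move=> [[|q] h]; first by rewrite C0 in h.
by have := coding_end q; rewrite h.
Qed.

Lemma coding_neq_a p : x p <> a -> exists q, C q = p.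
Proof.
by move=> h; have [q [_ [hq|[_ /h//]]]] := coding_pos p; exists q.
Qed.

Lemma occ_desub q w : occ x (C q) w <-> valid a w /\ occ x' q (desub a w).
Proof.
elim/(@desub_ind _ a): w q => [|r IH|b nb|b e r nb IH] q.
- by split => // _; split.
- rewrite /= eqxx !occ_cons coding_head.
  split => [[e]|[v [e o]]].
    have [_ <-] := coding_eq e; by rewrite IH => -[].
  split => //; have [_ <-] := coding_eq e; by rewrite IH.
- by rewrite /= (negbTE nb) !occ_cons coding_head; split=> [[]//|[]].
rewrite /= (negbTE nb) !occ_cons coding_head.
split => [[e1 [e2]]|[/andP[/eqP -> v] [e1 o]]]; rewrite -e1 in nb;
  have [_ xa s] := coding_neq nb; rewrite -s.
  rewrite IH => -[-> o]; split => //.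
  by rewrite -e2 xa eqxx.
by rewrite IH.
Qed.

(** Synchronisation: by [coding_eq_a] a word can be cut into images in one way only, so its
    occurrences in [x] come from those of its desubstitution in [x']. *)
Lemma occ_strip p w : w <> [::] ->
  occ x p w <-> valid a w /\
    exists q, C q = p + size (hd a w) /\ occ x' q (desub a (strip a w)).
Proof.
case: w => // b r _; have [->|nb] := eqVneq b a.
  rewrite /= eqxx occ_cons addn1 coding_eq_a; split.
    by move=> [[q hq]]; rewrite -hq occ_desub => -[v o]; split => //; exists q.
  move=> [v [q [hq o]]]; split; first by exists q.
  by rewrite -hq occ_desub.
rewrite [hd _ _]/= [strip _ _]/= (negbTE nb) addn0; split; last first.
  by move=> [v [q [<- o]]]; rewrite occ_desub; split.
move=> o; have [q hq] : exists q, C q = p.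
  by apply: coding_neq_a => e; move: o; rewrite occ_cons => -[h]; case/eqP: nb; rewrite -h.
by move: o; rewrite -hq occ_desub => -[v o]; split => //; exists q.
Qed.

End Coding.

(** * Reduction of a word to the empty word *)

Section Desubstitution.
Variables (A : eqType) (a : nat -> A).

(* w desubstitutes to the empty word in m steps, starting at level n; all
   occurrences of w in a word of level n then extend to z. *)
Inductive reduces : nat -> seq A -> nat -> seq A -> Prop :=
| reduces_nil n : reduces n [::] 0 [::]
| reduces_step n w m z : w <> [::] -> valid (a n) w ->
    reduces n.+1 (desub (a n) (strip (a n) w)) m z ->
    reduces n w m.+1 (hd (a n) w ++ ar_subst (a n) z).

(** These are the bispecial factors of an Arnoux-Rauzy word with directive sequence [a n], [a n.+1],
    and so on. By [reduces_bispecial] each is its own extension [z], so they serve as test words. *)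
Fixpoint bispecial n m :=
  if m is k.+1 then a n :: ar_subst (a n) (bispecial n.+1 k) else [::].

Lemma reduces_bispecial n m : reduces n (bispecial n m) m (bispecial n m).
Proof.
elim: m n => [|m IH] n; first exact: reduces_nil.
rewrite [bispecial n m.+1]/=; set w := _ :: _.
have e : w = hd (a n) w ++ ar_subst (a n) (bispecial n.+1 m) by rewrite /= eqxx.
rewrite [X in reduces _ _ _ X]e.
apply: reduces_step; rewrite /= ?eqxx ?valid_subst ?desub_subst //.
Qed.

Hypothesis a_inf : forall b n, exists2 m, n <= m & a m = b.

Section Languages.
Variable L : nat -> seq A -> Prop.

(** Induction on length. A word of two or more letters shrinks; a single letter stays until it
    equals the directive letter, and is then stripped to nothing. [L] is abstract to serve both for
    limit words and for the descended languages of a given word. *)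
Lemma reducesP :
  (forall n w, w <> [::] -> L n w ->
    valid (a n) w /\ L n.+1 (desub (a n) (strip (a n) w))) ->
  forall n w, L n w -> exists m z, reduces n w m z.
Proof.
move=> hL n w; have [s] := ubnP (size w); elim: s n w => // s IH n w sz Lw.
have step w' n' : w' <> [::] -> L n' w' ->
    (L n'.+1 (desub (a n') (strip (a n') w')) ->
     exists m z, reduces n'.+1 (desub (a n') (strip (a n') w')) m z) ->
    exists m z, reduces n' w' m z.
  move=> w0 Lw' h; have [v /h[m [z r]]] := hL _ _ w0 Lw'.
  by exists m.+1, (hd (a n') w' ++ ar_subst (a n') z); apply: reduces_step.
case: w sz Lw => [|b [|e r]] sz Lw; first by exists 0, [::]; apply: reduces_nil.
  have [m nm am] := a_inf b n.
  move: nm am; rewrite -(subnKC (leq0n n)) add0n subn0 => nm.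
  have [k ->] : exists k, m = n + k by exists (m - n); lia.
  elim: k n Lw {nm m sz} => [|k IHk] n Lw h.
    apply: step => //; rewrite /= -[in b == _]h addn0 eqxx => _.
    by exists 0, [::]; apply: reduces_nil.
  apply: step => //; rewrite /=; case: eqP => [_ _|nb].
    by exists 0, [::]; apply: reduces_nil.
  by rewrite /=; case: eqP => // _ Lb; apply: IHk => //; rewrite addSnnS.
apply: step => // Lr; apply: IH => //.
by have := @size_desub_strip _ (a n) [:: b, e & r]; rewrite -ltnS => /(_ isT); move: sz => /=; lia.
Qed.

(** Upwards, [w] is a factor of [a n] followed by the image of its desubstitution: by validity [w]
    lacks at most a final [a n] of that image. *)
Lemma reduces_lang :
  (forall n, L n [::]) ->
  (forall n u v w, L n (u ++ v ++ w) -> L n v) ->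
  (forall n w, L n.+1 w -> L n (a n :: ar_subst (a n) w)) ->
  forall n w m z, reduces n w m z -> L n w.
Proof.
move=> L0 Lf Ls n w m z; elim=> {n w m z} // n w m z w0 vw _ /Ls.
have vs : valid (a n) (strip (a n) w).
  by case: w w0 vw => //= b r _; case E: (b == a n); rewrite //= E.
have [t ->] := prefix_subst_desub vs.
case: w {w0 vw vs} => [|b r] /=; first by move=> _; apply: L0.
have [e|_] := eqVneq b (a n); last exact: (Lf _ [:: a n] (b :: r) t).
by rewrite e; exact: (Lf _ [::] (a n :: r) t).
Qed.

End Languages.
End Desubstitution.

Section Tower.
Variables (A : eqType) (a : nat -> A) (Y : nat -> nat -> A) (C : nat -> nat -> nat).

Definition tower := forall n, coding (a n) (Y n) (Y n.+1) (C n).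

Hypothesis hY : tower.

(** The position in [Y n] where the image of the letter [Y (n + m) q] under [m] substitutions
    starts. *)
Fixpoint cut n m q := if m is k.+1 then cut n k (C (n + k) q) else q.

Lemma cutS n m q : cut n m.+1 q = C n (cut n.+1 m q).
Proof.
elim: m q => [|m IH] q; first by rewrite /= addn0.
by rewrite [RHS]/= -IH /= addSnnS.
Qed.

(** Occurrences are carried from level to level by [occ_strip]. The threshold [P] keeps away from
    the origin, where the intermediate [z] may not fit before a cutting point. *)
Lemma reduces_occ n w m z : reduces a n w m z ->
  exists P, forall p, P <= p ->
    (occ (Y n) p w <-> exists j, p + size z = cut n m j) /\
    (occ (Y n) p w -> occ (Y n) p z).
Proof.
elim=> {n w m z} [n|n w m z w0 vw _ [P hP]].
  by exists 0 => p _; split => //; split => // _; exists p; rewrite addn0.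
exists (C n (P + size z)) => p hp.
have fwd : occ (Y n) p w -> (exists j, p + size (hd (a n) w ++ ar_subst (a n) z) = cut n m.+1 j)
    /\ occ (Y n) p (hd (a n) w ++ ar_subst (a n) z).
  move=> ow; have [_ [q [hq o]]] := (occ_strip (hY n) p w0).1 ow.
  have Pq : P <= q.
    by rewrite leqNgt; apply/negP => lt; have := @coding_mono _ _ _ _ _ (hY n) q (P + size z); lia.
  have [[h1 _] h2] := hP _ Pq.
  have [s e] := coding_occ (hY n) (h2 o).
  have [j hj] := h1 o; split.
    by exists j; rewrite cutS -hj e hq size_cat addnA.
  move: ow; rewrite [in X in X -> _](hd_strip (a n) w) occ_cat => -[oh _].
  by rewrite occ_cat -hq.
split; last by move=> /fwd[].
split=> [/fwd[] //|[j]].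
rewrite cutS; set Q := cut _ _ _ => hQ.
have PQ : P + size z <= Q.
  rewrite leqNgt; apply/negP => lt.
  by have := @coding_mono _ _ _ _ _ (hY n) _ _ lt; lia.
have [[_ h1] h2] := hP (Q - size z) ltac:(lia).
have o : occ (Y n.+1) (Q - size z) (desub (a n) (strip (a n) w)).
  by apply: h1; exists j; rewrite subnK //; lia.
have [s e] := coding_occ (hY n) (h2 o).
apply/(occ_strip (hY n) p w0); split => //; exists (Q - size z); split => //.
by move: e; rewrite subnK; [rewrite -hQ size_cat; lia|lia].
Qed.

Lemma cut_wt m q : cut 0 m q.+1 = cut 0 m q + wt a m (Y m q).
Proof.
elim: m q => [|m IH] q; rewrite /= ?add0n; first by rewrite addn1.
have [h|h] := eqVneq (Y m.+1 q) (a m).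
  have [e1 ->] := coding_eq (hY m) h.
  by rewrite IH e1 h ?eqxx /=; lia.
have [e1 e2 ->] := coding_neq (hY m) h.
by rewrite !IH e1 e2; lia.
Qed.

Lemma cut_mono m q r : q < r -> cut 0 m q < cut 0 m r.
Proof.
apply: (homo_ltn ltn_trans) => i; rewrite cut_wt.
by have := wt_gt0 a m (Y m i); lia.
Qed.

Lemma cut0 m : cut 0 m 0 = 0.
Proof. by elim: m => //= m; rewrite (hY m).1. Qed.

End Tower.

(** * Limit words *)

Lemma occ_infix (A : eqType) (x : nat -> A) p n i w :
  occ x p w -> p + size w <= n -> occ x i (window x 0 n) -> occ x (i + p) w.
Proof.
move=> o le; rewrite -(subnKC le) -addnA !window_cat !occ_cat !size_window add0n.
by rewrite o => -[_ []].
Qed.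

Section Limit.
Variables (A : eqType) (a : nat -> A) (c c' : A).
Hypothesis cc' : c' != c.
Hypothesis a_inf : forall b n, exists2 m, n <= m & a m = b.

Fixpoint approx b n m := if m is k.+1 then ar_subst (a n) (approx b n.+1 k) else [:: b].

Lemma ar_subst_compE n : ar_subst_comp a n [:: c] = approx c 0 n.+1.
Proof.
rewrite /ar_subst_comp /mkseq; move: (n.+1) 0 => m; elim: m => //= m IH k.
by rewrite IH.
Qed.

(** The image of [c] starts with [c], so the approximants are nested; a directive letter other than
    [c] makes the image of [c] longer. *)
Lemma approxS n m : exists t,
  approx c n m.+1 = approx c n m ++ t /\ (a (n + m) != c -> t != [::]).
Proof.
elim: m n => [|m IH] n.
  rewrite /= /ar_subst /= addn0; case: eqVneq => [->|h].
    by exists [::]; rewrite eqxx.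
  by exists [:: a n]; split.
have [t [e ht]] := IH n.+1; exists (ar_subst (a n) t); split.
  by rewrite [LHS]/= -/(approx c n.+1 m.+1) e ar_subst_cat.
rewrite addnS -addSn => /ht; case: t {e ht} => // b t _.
by rewrite ar_subst_cons; case: (b == a n).
Qed.

Lemma approx_prefix n m k : m <= k -> exists t, approx c n k = approx c n m ++ t.
Proof.
elim: k => [|k IH]; first by case: m => // _; exists [::]; rewrite cats0.
rewrite leq_eqVlt => /predU1P[->|/IH[t e]]; first by exists [::]; rewrite cats0.
by have [t' [-> _]] := approxS n k; exists (t ++ t'); rewrite e catA.
Qed.

Lemma approx_unbounded n k : exists m, k < size (approx c n m).
Proof.
elim: k => [|k [m hm]]; first by exists 0.
have [j nj aj] := a_inf c' (n + m).
have e : n + (j - n) = j by lia.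
have [t [e1 ht]] := approxS n (j - n).
have [s e2] := @approx_prefix n m (j - n) ltac:(lia).
exists (j - n).+1; rewrite e1 e2 !size_cat.
by case: t ht {e1} => [|? ?] /=; [rewrite e aj cc' => /(_ isT)|lia].
Qed.

Lemma limit_word_exists :
  exists Y : nat -> nat -> A, forall n m, occ (Y n) 0 (approx c n m).
Proof.
pose f n k := xchoose (approx_unbounded n k).
have hf n k : k < size (approx c n (f n k)) by apply: (xchooseP (approx_unbounded n k)).
exists (fun n i => nth c (approx c n (f n i)) i) => n m.
rewrite /occ; apply: (@eq_from_nth _ c) => [|i]; rewrite size_window // => lt.
rewrite nth_mkseq // add0n.
have := hf n i; have [le lt'|le lt'] := leqP m (f n i).
  by have [t ->] := approx_prefix n le; rewrite nth_cat lt.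
by have [t ->] := approx_prefix n (ltnW le); rewrite nth_cat lt'.
Qed.

Variable Y : nat -> nat -> A.
Hypothesis hYl : forall n m, occ (Y n) 0 (approx c n m).

Definition cuts n q := size (ar_subst (a n) (window (Y n.+1) 0 q)).

Lemma limit_tower : tower a Y cuts.
Proof.
move=> n; split => // q.
have e1 : window (Y n.+1) 0 q.+1 = window (Y n.+1) 0 q ++ [:: Y n.+1 q].
  by rewrite -[q.+1]addn1 window_cat [window _ _ 1]window_cons.
split; last by rewrite /cuts e1 ar_subst_cat size_cat.
have [m hm] := approx_unbounded n.+1 q.
have e2 : approx c n.+1 m = window (Y n.+1) 0 (q.+1 + (size (approx c n.+1 m) - q.+1)).
  by rewrite subnKC // (hYl n.+1 m).
have := hYl n m.+1; rewrite [approx c n _]/= e2.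
rewrite window_cat e1 !ar_subst_cat !occ_cat add0n.
by move=> [[]].
Qed.

Lemma limit_word_lim : word_lim (fun n => ar_subst_comp a n [:: c]) (Y 0).
Proof.
move=> m; have [N hN] := approx_unbounded 0 m; exists N => n Nn.
rewrite ar_subst_compE; have [t e] := @approx_prefix 0 N n.+1 (leqW Nn).
rewrite e -(hYl 0 N) -(subnKC (ltnW hN)) window_cat -catA.
exact: prefix_prefix.
Qed.

Lemma word_lim_unique y :
  word_lim (fun n => ar_subst_comp a n [:: c]) y -> y =1 Y 0.
Proof.
move=> hy i; have [N /(_ N (leqnn N))] := hy i.+1.
rewrite ar_subst_compE => /prefixP[t e].
have := hYl 0 N.+1; rewrite e => /occ_cat[].
rewrite /occ size_mkseq => /(congr1 (nth c ^~ i)).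
by rewrite !nth_mkseq // add0n.
Qed.

Lemma tower_occ n m q :
  occ (Y n) (cut cuts n m q) (approx (Y (n + m) q) n m).
Proof.
elim: m n => [|m IH] n; first by rewrite occ_cons addn0.
by rewrite cutS; have [] := coding_occ (limit_tower n) (IH n.+1); rewrite addSnnS.
Qed.

(** At a level whose directive letter is [b], every image ends with [b]. Further down [b] survives
    as the first letter of its image. *)
Lemma letter_inf n b N : exists2 p, N <= p & Y n p = b.
Proof.
have [m nm] := a_inf b n; rewrite -(subnKC nm).
move: (m - n) => k; elim: k n {nm} => [|k IH] n am.
  exists (cuts n N.+1).-1.
    by have := coding_ge (limit_tower n) N.+1; lia.
  by rewrite (coding_end (limit_tower n)) -am addn0.
have [|p Np hp] := IH n.+1; first by rewrite addSnnS.
exists (cuts n p); last by rewrite (coding_head (limit_tower n)).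
exact: leq_trans Np (coding_ge (limit_tower n) p).
Qed.

Definition recurrent_factor n w := forall N, exists2 p, N <= p & occ (Y n) p w.

(** A factor lies in a prefix that is the image of the letter [c] of a higher level, and [c] recurs
    there. *)
Lemma factor_recurrent n w : factor (Y n) w <-> recurrent_factor n w.
Proof.
split; last by move=> /(_ 0)[p _ o]; exists p.
move=> [p o] N; have [m hm] := approx_unbounded n (p + size w).
have [q Nq hq] := letter_inf (n + m) c N.
exists (cut cuts n m q + p).
  have : q <= cut cuts n m q.
    elim: (m) n {hm hq o} => // k IH n; rewrite cutS.
    by apply: leq_trans (IH n.+1) (coding_ge (limit_tower n) _).
  by lia.
have := tower_occ n m q; rewrite hq -(hYl n m); apply: occ_infix => //; exact: ltnW.
Qed.

(** This describes the language of [Y 0] by the directive sequence alone, so that another word can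
    be compared with [Y 0]. *)
Lemma factor_reduces w :
  factor (Y 0) w <-> exists m z, reduces a 0 w m z.
Proof.
rewrite factor_recurrent; split.
  apply: (reducesP a_inf) => n v v0 h; split.
    by have [p _ /(occ_strip (limit_tower n) _ v0)[]] := h 0.
  move=> N; have [p Np /(occ_strip (limit_tower n) _ v0)[_ [q [hq o]]]] := h (cuts n N).
  exists q => //; rewrite leqNgt; apply/negP => lt.
  by have := coding_mono (limit_tower n) lt; lia.
move=> [m [z r]]; apply: reduces_lang r => [n N|n u v v' h N|n v h N].
- by exists N.
- have [p Np] := h N; rewrite !occ_cat => -[_ [o _]]; exists (p + size u) => //; lia.
have [[|q] // Nq o] := h N.+1; exists (cuts n q.+1).-1.
  by have := coding_ge (limit_tower n) q.+1; lia.
rewrite occ_cons (coding_end (limit_tower n)); split => //.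
rewrite prednK; first by have [] := coding_occ (limit_tower n) o.
by have := coding_ge (limit_tower n) q.+1; lia.
Qed.

End Limit.

(** * Letter counts under desubstitution *)

Section LetterCounts.
Variable A : eqType.

Definition letters (x : nat -> A) b p := count_mem b (window x 0 p).

Lemma lettersS x b p : letters x b p.+1 = letters x b p + (x p == b).
Proof. by rewrite /letters -addn1 window_cat count_cat window_cons /= addn0 add0n. Qed.

Lemma coding_letters (a : A) x x' C : coding a x x' C -> forall q,
  letters x a (C q) = q /\ forall b, b != a -> letters x b (C q) = letters x' b q.
Proof.
move=> hC; elim=> [|q [IHa IHb]]; first by rewrite hC.1.
have [h|h] := eqVneq (x' q) a.
  have [e1 ->] := coding_eq hC h; rewrite !lettersS e1 IHa eqxx addn1; split => // b nb.
  by rewrite !lettersS e1 h IHb.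
have [e1 e2 ->] := coding_neq hC h; rewrite !lettersS e1 e2 IHa eqxx (negbTE h) addn0 addn1.
split => // b nb; rewrite !lettersS e1 e2 IHb // [a == b]eq_sym (negbTE nb); lia.
Qed.

(** Take for [q] the number of images that meet the first [p] letters. Each contains one [a], and
    only the [a] of the last one can be missing. *)
Lemma coding_letters_pos (a : A) x x' C : coding a x x' C -> forall p,
  exists q, [/\ q <= p, letters x a p <= q <= (letters x a p).+1 &
    forall b, b != a -> letters x b p = letters x' b q].
Proof.
move=> hC p; have [q [qp [h|[h xa q0]]]] := coding_pos hC p;
  exists q; have [ha hb] := coding_letters hC q.
  by split => // [|b /hb <-]; rewrite -?h ?ha; [lia|].
move: ha hb; rewrite h lettersS xa eqxx => ha hb; split => // [|b nb]; first by lia.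
by rewrite -hb // lettersS xa eq_sym (negbTE nb) addn0.
Qed.

End LetterCounts.

Lemma sum_letters (A : finType) (x : nat -> A) p : \sum_b letters x b p = p.
Proof.
elim: p => [|p IH]; first by rewrite big1.
rewrite (eq_bigr (fun b => letters x b p + (x p == b))); last by move=> b _; rewrite lettersS.
rewrite big_split IH /= (bigD1 (x p)) //= eqxx big1 ?addn0 ?addn1 // => b.
by rewrite eq_sym => /negbTE ->.
Qed.

(** * Balance of letters and of cutting points *)

Section LetterBalance.
Local Open Scope ring_scope.
Variables (A : finType) (a : nat -> A) (Y : nat -> nat -> A) (C : nat -> nat -> nat).
Variable K : nat.
Hypothesis card_A : (#|A| <= 3)%N.
Hypothesis hY : tower a Y C.
Hypothesis a_inf : forall b n, exists2 m, (n <= m)%N & a m = b.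
Hypothesis hK : run_bound a K.

Lemma letters_le (x : nat -> A) b p : (letters x b p <= p)%N.
Proof. by rewrite -[leqRHS](size_window x 0); apply: count_size. Qed.

Lemma sum_lettersz (x : nat -> A) p : \sum_b (letters x b p)%:Z = p%:Z.
Proof. by rewrite -(big_morph Posz PoszD (erefl _)) sum_letters. Qed.

(* A missing third letter is represented by an index with zero imbalance. *)
Lemma letter_balance b (q r q' r' : nat) : (r + q' = r' + q)%N ->
  `|(letters (Y 0) b r)%:Z - (letters (Y 0) b q)%:Z
    - (letters (Y 0) b r')%:Z + (letters (Y 0) b q')%:Z| <= balance_bound K.
Proof.
move=> hqr.
pose e (b : A) : 'I_3 := widen_ord card_A (enum_rank b).
have e_inj : injective e.
  by move=> b1 b2 /(congr1 val) /= h; apply: enum_rank_inj; apply: val_inj.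
have [f hf] : exists f : nat -> nat -> nat, forall m p,
    [/\ (f m p <= p)%N, (letters (Y m) (a m) p <= f m p <= (letters (Y m) (a m) p).+1)%N &
     forall b, b != a m -> letters (Y m) b p = letters (Y m.+1) b (f m p)].
  exists (fun m => projT1 (choice (coding_letters_pos (hY m)))) => m p.
  exact: (projT2 (choice (coding_letters_pos (hY m)))).
(* [orb p m] is the prefix length at level [m] that corresponds to the first [p] letters of [Y 0],
   up to the rounding in [hf]. The windows compared run from [q] to [r] and from [q'] to [r']. *)
pose orb := fix orb p m := if m is k.+1 then f k (orb p k) else p.
have orb_le p m : (orb p m <= p)%N.
  by elim: m => //= m IH; have [le _ _] := hf m (orb p m); apply: leq_trans le IH.
pose term m b : int := (letters (Y m) b (orb r m))%:Z - (letters (Y m) b (orb q m))%:Z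
    - (letters (Y m) b (orb r' m))%:Z + (letters (Y m) b (orb q' m))%:Z.
pose delta m i : int := \sum_(b | e b == i) term m b.
have deltaE m b0 : delta m (e b0) = term m b0.
  by rewrite /delta (eq_bigl (pred1 b0)) ?big_pred1_eq // => b1; rewrite /= (inj_eq e_inj).
have delta0 m i : (forall b, e b <> i) -> delta m i = 0.
  by move=> h; rewrite /delta big_pred0 // => b1; apply/eqP/h.
have sum_delta m : \sum_i delta m i =
    (orb r m)%:Z - (orb q m)%:Z - (orb r' m)%:Z + (orb q' m)%:Z.
  have -> : \sum_i delta m i = \sum_b term m b by rewrite [RHS](partition_big e xpredT).
  by rewrite /term big_split !sumrB /= !sum_lettersz.
have him : imbalance (e \o a) delta.
  split => [m i ni|m|].
  - apply: eq_bigr => b1 /eqP eb; rewrite /term /=.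
    have nb : b1 != a m by apply/eqP => h; apply: ni; rewrite -eb h.
    have h p : letters (Y m) b1 (orb p m) = letters (Y m.+1) b1 (f m (orb p m)).
      by have [_ _ ->] := hf m (orb p m).
    by rewrite !h.
  - rewrite deltaE sum_delta /term /=.
    have [_ h1 _] := hf m (orb r m); have [_ h2 _] := hf m (orb q m).
    have [_ h3 _] := hf m (orb r' m); have [_ h4 _] := hf m (orb q' m).
    by lia.
  - by rewrite sum_delta /=; lia.
have im_or i : (exists b0, e b0 = i) \/ (forall b0, e b0 <> i).
  by have [h|/forallNP h] := pselect (exists b0, e b0 = i); [left|right].
have -> : (letters (Y 0) b r)%:Z - (letters (Y 0) b q)%:Z
    - (letters (Y 0) b r')%:Z + (letters (Y 0) b q')%:Z = delta 0 (e b) by rewrite deltaE.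
(* Prefix lengths do not grow along the levels, so the sum of the four initial ones bounds the
   imbalance throughout. *)
apply: (@imbalance_bounded K (r + q + r' + q') (e \o a)) => // [m|i|m i].
- by have [i iK ni] := hK m; exists i => //= /e_inj.
- have [[b0 <-]|h] := im_or i; last by right => m; apply: delta0.
  by left => m; have [k mk ak] := a_inf b0 m; exists k => //=; rewrite ak.
have [[b0 <-]|h] := im_or i; last by rewrite delta0.
have lel p : (letters (Y m) b0 (orb p m) <= p)%N by apply: leq_trans (letters_le _ _ _) (orb_le _ _).
have := lel q; have := lel r; have := lel q'; have := lel r'.
by rewrite deltaE /term; lia.
Qed.

End LetterBalance.

Lemma tower_shift (A : eqType) (a : nat -> A) Y C m :
  tower a Y C -> tower (fun n => a (n + m)) (fun n => Y (n + m)) (fun n => C (n + m)).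
Proof. by move=> h n; apply: h. Qed.

Lemma rank_exists (f : nat -> nat) : f 0 = 0 -> {homo f : q r / q < r} ->
  exists r : nat -> nat, forall p j, (j < r p) = (f j < p).
Proof.
move=> f0 fm.
have fge j : j <= f j by elim: j => // j IH; apply: leq_ltn_trans IH (fm _ _ (ltnSn j)).
have hex p : exists r, p <= f r /\ forall j, p <= f j -> r <= j.
  by case: (ex_minnP (ex_intro (fun j => p <= f j) p (fge p))) => j; exists j.
have [r hr] := choice hex.
exists r => p j; have [h1 h2] := hr p.
rewrite !ltnNge; congr negb; apply/idP/idP; last exact: h2.
by rewrite leq_eqVlt => /predU1P[<-//|/fm /ltnW]; apply: leq_trans.
Qed.

Definition hits (f : nat -> nat) i l :=
  count (fun t => `[< exists j, i + t = f j >]) (iota 0 l).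

Lemma hits_rank f r i l : {homo f : q r / q < r} ->
  (forall p j, (j < r p) = (f j < p)) -> hits f i l + r i = r (i + l).
Proof.
move=> fm hr; have fle := leq_mono fm.
have eqr x y : (forall j, (j < x) = (j < y)) -> x = y.
  by move=> h; apply/eqP; rewrite eqn_leq leqNgt h ltnn /= leqNgt -h ltnn.
have step p : r p.+1 = r p + `[< exists j, p = f j >].
  case: asboolP => [[j0 ->]|hno].
    rewrite addn1; have -> : r (f j0) = j0.
      by apply: eqr => j; rewrite hr (leqW_mono fle).
    by apply: eqr => j; rewrite hr !ltnS fle.
  rewrite addn0; apply: eqr => j; rewrite !hr ltnS leq_eqVlt.
  by case: eqP => // h; case: hno; exists j.
elim: l => [|l IH]; first by rewrite addn0.
by rewrite addnS step -IH /hits -[l.+1]addn1 iotaD count_cat /= add0n addn0; lia.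
Qed.

Section CutBalance.
Variables (A : finType) (a : nat -> A) (Y : nat -> nat -> A) (C : nat -> nat -> nat).
Variable K : nat.
Hypothesis card_A : 1 < #|A| <= 3.
Hypothesis hY : tower a Y C.
Hypothesis a_inf : forall b n, exists2 m, n <= m & a m = b.
Hypothesis hK : run_bound a K.

Lemma cut_letters m q :
  ((cut C 0 m q)%:Z = \sum_b (wt a m b)%:Z * (letters (Y m) b q)%:Z)%R.
Proof.
elim: q => [|q IH]; first by rewrite (cut0 hY) big1 // => b _; rewrite mulr0.
rewrite (cut_wt hY) PoszD IH.
rewrite [RHS](eq_bigr (fun b => (wt a m b)%:Z * (letters (Y m) b q)%:Z +
   (wt a m b)%:Z * (Y m q == b)%:Z)%R); last by move=> b _; rewrite lettersS PoszD mulrDr.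
rewrite big_split /=; congr (_ + _)%R.
rewrite (bigD1 (Y m q)) //= eqxx mulr1 big1 ?addr0 // => b.
by rewrite eq_sym => /negbTE ->; rewrite mulr0.
Qed.

Lemma two_letters : exists b c : A, b <> c.
Proof. by have /andP[/card_gt1P[b [c [_ _ /eqP bc]]] _] := card_A; exists b, c. Qed.

Lemma cut_spacing m b q k :
  k * wt a m b + K.+2 * cut C 0 m q <= K.+2 * cut C 0 m (q + k).
Proof.
have [b0 [c0 bc]] := two_letters.
elim: k => [|k IH]; first by rewrite addn0.
rewrite addnS (cut_wt hY).
by have := wt_ratio bc m b (Y m (q + k)) hK; lia.
Qed.

(** The stretches hold equally many letters of [Y m], so their lengths differ by the letter
    imbalances times the weights, each weight being at most [K.+2] times that of [b]. *)
Lemma cut_length_balance m b (q r q' r' : nat) : r + q' = r' + q ->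
  ((cut C 0 m r')%:Z - (cut C 0 m q')%:Z <= (cut C 0 m r)%:Z - (cut C 0 m q)%:Z +
    #|A|%:Z * K.+2%:Z * (wt a m b)%:Z * balance_bound K)%R.
Proof.
move=> hqr; rewrite !cut_letters -subr_ge0.
have [b0 [c0 bc]] := two_letters.
have D0 : (0 <= balance_bound K)%R by rewrite /balance_bound; lia.
have [_ card3] := andP card_A.
have bal c := @letter_balance _ _ _ _ K card3 (tower_shift m hY) _ _ c q r q' r' hqr.
have {}bal c : (`|(letters (Y m) c r)%:Z - (letters (Y m) c q)%:Z -
   (letters (Y m) c r')%:Z + (letters (Y m) c q')%:Z| <= balance_bound K)%R.
  apply: bal => [b1 n|n].
    have [k nk ak] := a_inf b1 (n + m); exists (k - m); first by lia.
    by rewrite subnK //; lia.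
  have [i iK ni] := hK (n + m); exists i => // h; apply: ni.
  by rewrite -h; congr a; lia.
have : (\sum_c ((wt a m c)%:Z * ((letters (Y m) c r)%:Z - (letters (Y m) c q)%:Z -
   (letters (Y m) c r')%:Z + (letters (Y m) c q')%:Z) +
    K.+2%:Z * (wt a m b)%:Z * balance_bound K) >= 0)%R.
  apply: sumr_ge0 => c _; have := bal c; set t := (_ + _)%R => ht.
  have hw := wt_ratio bc m c b hK.
  have t1 : (0 <= (wt a m c)%:Z * (balance_bound K + t))%R by apply: mulr_ge0; lia.
  have t2 : (0 <= (K.+2%:Z * (wt a m b)%:Z - (wt a m c)%:Z) * balance_bound K)%R.
    by apply: mulr_ge0 => //; lia.
  by lia.
rewrite big_split /= sumr_const; set S1 := (\sum_c _)%R.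
have -> : S1 = ((\sum_c (wt a m c)%:Z * (letters (Y m) c r)%:Z -
   \sum_c (wt a m c)%:Z * (letters (Y m) c q)%:Z) -
   (\sum_c (wt a m c)%:Z * (letters (Y m) c r')%:Z -
   \sum_c (wt a m c)%:Z * (letters (Y m) c q')%:Z))%R.
  rewrite -!sumrB; apply: eq_bigr => c _; lia.
rewrite -mulr_natl natz => h; apply: le_trans h _.
have -> : #|(xpredT : pred A)| = #|A| by apply: eq_card.
by move: (\sum_c _)%R (\sum_c _)%R (\sum_c _)%R (\sum_c _)%R => s1 s2 s3 s4; lia.
Qed.

(** At most 3 letters, one factor [K.+2] for comparing weights, the other for the spacing of cutting
    points, and 2 for the window ends. *)
Definition cut_discrepancy := 3 * K.+2 * K.+2 * `|balance_bound K|%N + 2.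

Lemma cut_balance m i i' l :
  hits (cut C 0 m) i l <= hits (cut C 0 m) i' l + cut_discrepancy.
Proof.
have cm := @cut_mono _ _ _ _ hY m.
have [r hr] := rank_exists (cut0 hY m) cm.
have [b _] := two_letters.
have := hits_rank i l cm hr; have := hits_rank i' l cm hr.
set N := hits _ i l; set N' := hits _ i' l => e' e.
rewrite leqNgt; apply/negP => big.
set q0 := r i; set q1 := r (i + l); set p0 := r i'; set p1 := r (i' + l).
have h1 : cut C 0 m q1.-1 < i + l by rewrite -hr -/q1; rewrite /q1 /cut_discrepancy in big *; lia.
have h2 : i <= cut C 0 m q0 by rewrite leqNgt -hr ltnn.
have h3 : i' + l <= cut C 0 m p1 by rewrite leqNgt -hr ltnn.
have h4 : cut C 0 m p0.-1 <= i'.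
  have [->|p0_gt0] := posnP p0; first by rewrite (cut0 hY).
  by apply: ltnW; rewrite -hr -/p0 prednK.
(* The [p1 - p0.-1] letters from [p0.-1] on cover the second window. As many from [q0] on are almost
   as long, and then the [N - N' - 2] further letters up to [q1.-1] no longer fit into the first
   window. *)
have len : q0 + (p1 - p0.-1) + p0.-1 = p1 + q0 by rewrite /p0 /p1; lia.
have := cut_length_balance m b len.
have hle : q0 + (p1 - p0.-1) + (N - N' - 2) <= q1.-1.
  by rewrite /p0 /p1 /q0 /q1; rewrite /cut_discrepancy in big; lia.
have := cut_spacing m b (q0 + (p1 - p0.-1)) (N - N' - 2).
have fle := leq_mono cm; have := hle; rewrite -fle.
set f1 := cut C 0 m _; set f2 := cut C 0 m q1.-1; set f3 := cut C 0 m (q0 + (p1 - p0.-1)).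
move=> h5 h6 h7.
have D0 : (0 <= balance_bound K)%R by rewrite /balance_bound; lia.
have w0 := wt_gt0 a m b.
have [_ card3] := andP card_A.
set X := 3 * K.+2 * wt a m b * `|balance_bound K|%N.
have h8 : i + l <= f3 + X.
  have hX : (#|A|%:Z * K.+2%:Z * (wt a m b)%:Z * balance_bound K <= X%:Z)%R.
    rewrite /X !PoszM gez0_abs //; do 3 (apply: ler_wpM2r => //).
  move: (_ * balance_bound K)%R hX h7 => Z hX h7; lia.
have h9 : (3 * K.+2 * K.+2 * `|balance_bound K|%N) * wt a m b <= (N - N' - 2) * wt a m b.
  by rewrite leq_mul2r; apply/orP; right; rewrite /cut_discrepancy in big; lia.
have h10 : K.+2 * f2 + K.+2 <= K.+2 * (f3 + X).
  by rewrite addnC -mulnS leq_mul2l /=; lia.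
have h11 : K.+2 * f1 <= K.+2 * f2 by rewrite leq_mul2l.
have h12 : K.+2 * X = 3 * K.+2 * K.+2 * `|balance_bound K|%N * wt a m b.
  by rewrite /X !mulnA; lia.
by rewrite mulnDr h12 in h10; lia.
Qed.

End CutBalance.

(** * Factor-balance and runs of the directive sequence *)

Lemma occurrences_window (A : eqType) (x : nat -> A) i l w :
  occurrences w (window x i l) =
  if size w <= l then count (fun t => `[< occ x (i + t) w >]) (iota 0 (l - size w).+1)
  else 0.
Proof.
have pre t : t <= l -> prefix w (drop t (window x i l)) =
    (t + size w <= l) && `[< occ x (i + t) w >].
  move=> tl; rewrite -{1}(subnKC tl) window_cat drop_size_cat ?size_window //.
  apply/idP/andP => [/prefixP[s e]|[le /asboolP o]].
    have sz := congr1 size e; rewrite size_window size_cat in sz.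
    split; first by lia.
    apply/asboolP; have := occ_window x (i + t) (l - t).
    by rewrite e occ_cat => -[].
  have -> : l - t = size w + (l - t - size w) by lia.
  by rewrite window_cat o prefix_prefix.
rewrite /occurrences size_window.
case: leqP => [le|lt].
  have -> : l.+1 = (l - size w).+1 + size w by lia.
  rewrite iotaD count_cat addnC.
  have -> : count (fun t => prefix w (drop t (window x i l)))
      (iota (0 + (l - size w).+1) (size w)) = 0.
    apply/eqP; rewrite -leqn0 leqNgt -has_count; apply/hasP => -[t].
    rewrite mem_iota => h; rewrite pre; last by lia.
    by case: leqP => //=; lia.
  rewrite add0n; apply: eq_in_count => t; rewrite mem_iota => h.
  by rewrite pre; [case: leqP => //=|]; lia.
apply/eqP; rewrite -leqn0 leqNgt -has_count; apply/hasP => -[t].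
rewrite mem_iota => h; rewrite pre; last by lia.
by case: leqP => //=; lia.
Qed.

Lemma factor_window (A : eqType) (x : nat -> A) i n : factor x (window x i n).
Proof. by exists i; rewrite size_window. Qed.

Section Occurrences.
Variables (A : finType) (a : nat -> A) (c c' : A).
Hypothesis cc' : c' != c.
Hypothesis a_inf : forall b n, exists2 m, n <= m & a m = b.
Variable Y : nat -> nat -> A.
Hypothesis hYl : forall n m, occ (Y n) 0 (approx a c n m).

Notation C := (cuts a Y).
Let hY : tower a Y C := limit_tower cc' a_inf hYl.

Lemma occurrences_hits w m z : reduces a 0 w m z ->
  exists P, forall i, P <= i -> forall l, size w <= l ->
    occurrences w (window (Y 0) i l) =
    hits (cut C 0 m) (i + size z) (l - size w).+1.
Proof.
move=> /(reduces_occ hY)[P hP]; exists P => i Pi l wl.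
rewrite occurrences_window wl; apply: eq_count => t.
have [h _] := hP (i + t) ltac:(lia).
by apply: asbool_equiv_eq; rewrite h addnAC.
Qed.

Lemma late_window u : factor (Y 0) u ->
  forall P, exists2 i, P <= i & u = window (Y 0) i (size u).
Proof.
move=> /(factor_recurrent cc' a_inf hYl) h P.
by have [p Pp o] := h P; exists p.
Qed.

Lemma run_bound_balanced K : 1 < #|A| <= 3 -> run_bound a K ->
  uniformly_factor_balanced (Y 0).
Proof.
move=> hA hK; exists (cut_discrepancy K); first by rewrite /cut_discrepancy; lia.
move=> w u v fu fv suv.
suff le u' v' : factor (Y 0) u' -> factor (Y 0) v' -> size u' = size v' ->
    occurrences w u' <= occurrences w v' + cut_discrepancy K.
  by have := le _ _ fu fv suv; have := le _ _ fv fu (esym suv); lia.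
move=> {u v fu fv suv} fu fv suv.
have [wl|lw] := leqP (size w) (size u'); last first.
  have [i _ ->] := late_window fu 0.
  by rewrite occurrences_window (leqNgt (size w)) lw.
have [/(factor_reduces cc' a_inf hYl)[m [z r]]|nf] := pselect (factor (Y 0) w).
  have [P hP] := occurrences_hits r.
  have [i Pi ->] := late_window fu P; have [i' Pi' ->] := late_window fv P.
  rewrite !hP -?suv //; exact: (cut_balance hA hY a_inf hK).
have [i _ ->] := late_window fu 0.
rewrite occurrences_window wl.
rewrite (@eq_count _ _ pred0) ?count_pred0 // => t.
by apply/negbTE/asboolP => o; apply: nf; exists (i + t).
Qed.

Lemma approx_nseq b n m : (forall i, i < m -> a (n + i) = a n) -> b != a n ->
  approx a b n m = b :: nseq m (a n).
Proof.
elim: m n => [//|m IH] n h nb; rewrite [LHS]/=.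
case: m IH h => [|m] IH h.
  by rewrite /ar_subst /= (negbTE nb).
have h1 : a n.+1 = a n by rewrite -(h 1) // addn1.
rewrite IH ?h1 // => [|i im]; last by rewrite addSnnS h.
have sub k : ar_subst (a n) (nseq k (a n)) = nseq k (a n).
  by elim: k => // k IHk; rewrite [nseq _ _]/= ar_subst_cons eqxx IHk.
by rewrite ar_subst_cons (negbTE nb) sub.
Qed.

Lemma wt_run n j b : (forall i, i < j -> a (n + i) = a n) -> b != a n ->
  wt a (n + j) (a n) = wt a n (a n) /\ j * wt a (n + j) (a n) <= wt a (n + j) b.
Proof.
elim: j => [|j IH] h nb; first by rewrite addn0.
have [i ij|e1 le1] := IH _ nb; first by apply: h; lia.
rewrite addnS /= (h j) // eqxx nb /=; split; first by lia.
by move: le1; rewrite mulSn; lia.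
Qed.

(* In the middle of a long run of the letter a n, at level m, the image of
   (a n)^j and that of a single other letter have comparable lengths. *)
Lemma balanced_run_bound B :
  (forall w u v : seq A, factor (Y 0) u -> factor (Y 0) v -> size u = size v ->
     `|occurrences w u - occurrences w v|%N <= B) ->
  run_bound a (B.+3).*2.
Proof.
move=> hB n; apply: contrapT => hno.
have run i : i <= (B.+3).*2 -> a (n + i) = a n.
  by move=> le; apply: contrapT => h; apply: hno; exists i.
(* The [j] steps before [m] make the image of [b] heavy; the [j] steps after it put a [b] followed
   by [j] letters [a n] into [Y m]. The hit counts, [j] and at most 1, then differ by more than
   [B]. *)
set j := B.+3 in run; pose m := n + j.
have am : a m = a n by apply: run; lia.
have [b nb] : exists b, b != a n.
  by have [<-|h] := eqVneq c (a n); [exists c'|exists c].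
have [w1 w2] := @wt_run n j b (fun i ij => run i ltac:(lia)) nb.
rewrite -/m in w1 w2; set wa := wt a m (a n) in w1 w2.
have wa0 : 0 < wa := wt_gt0 a m (a n).
have [P hP] := occurrences_hits (reduces_bispecial a 0 m).
set W := bispecial a 0 m in hP; set s := size W in hP.
have cm := @cut_mono _ _ _ _ hY m.
have cge q : q <= cut C 0 m q.
  by elim: q => // q IH; apply: leq_ltn_trans IH (cm _ _ (ltnSn q)).
have [q0 Pq0 hq0] := letter_inf cc' a_inf hYl (m + j) b (P + s).
pose q := cut C m j q0.
have Pq : P + s <= q.
  apply: leq_trans Pq0 _; rewrite /q.
  by elim: (j) (m) => // k IH m'; rewrite cutS; apply: leq_trans (IH m'.+1) (coding_ge (hY m') _).
have := tower_occ cc' a_inf hYl m j q0; rewrite hq0 -/q approx_nseq ?am //; last first.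
  by move=> i ij; rewrite /m -addnA; apply: run; lia.
move=> /occ_cons[Yq Ya].
have {}Ya t : t < j -> Y m (q.+1 + t) = a n.
  by move=> tj; rewrite (occ_nth (a n) Ya) ?size_nseq // nth_nseq tj.
have f1 : cut C 0 m q.+1 = cut C 0 m q + wt a m b by rewrite (cut_wt hY) Yq.
have f2 t : t <= j -> cut C 0 m (q.+1 + t) = cut C 0 m q.+1 + t * wa.
  elim: t => [|t IH] tj; first by rewrite !addn0.
  by rewrite addnS (cut_wt hY) IH ?Ya // ?mulSn; lia.
have [r hr] := rank_exists (cut0 hY m) cm.
have fle := leq_mono cm.
have rf p : r (cut C 0 m p) = p.
  apply/eqP; rewrite eqn_leq; apply/andP; split; rewrite leqNgt.
    by rewrite hr ltnn.
  by apply/negP => lt; have := hr (cut C 0 m p) (r (cut C 0 m p)); rewrite ltnn (leqW_mono fle) lt.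
pose l := j * wa.
have l0 : 0 < l by rewrite /l muln_gt0 wa0.
have hits1 : hits (cut C 0 m) (cut C 0 m q.+1) l = j.
  have := hits_rank (cut C 0 m q.+1) l cm hr.
  by rewrite -f2 // !rf; lia.
(* This window starts just inside the image of [b], whose length is at least [l], so at most the end
   of that image is hit. *)
have hits2 : hits (cut C 0 m) (cut C 0 m q).+1 l <= 1.
  have := hits_rank (cut C 0 m q).+1 l cm hr.
  have : ~~ (q.+2 < r ((cut C 0 m q).+1 + l)).
    by rewrite hr -leqNgt; have := f2 1 isT; rewrite addn1 => ->; rewrite f1 /l; lia.
  have : q < r (cut C 0 m q).+1 by rewrite hr.
  by lia.
(* Starting [s] earlier aligns the ends of the occurrences of [W] with the cutting points; the
   length leaves exactly [l] starting positions. *)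
pose u := window (Y 0) (cut C 0 m q.+1 - s) (l + s - 1).
pose v := window (Y 0) ((cut C 0 m q).+1 - s) (l + s - 1).
have fu : factor (Y 0) u by apply: factor_window.
have fv : factor (Y 0) v by apply: factor_window.
have := hB W u v fu fv.
rewrite !size_window => /(_ erefl).
have cgeq := cge q; have cgeq' := cge q.+1.
rewrite !hP -/s; try lia.
rewrite !subnK; try lia.
have -> : (l + s - 1 - s).+1 = l by lia.
by rewrite hits1; lia.
Qed.

End Occurrences.

(** * Weak partial quotients *)

Section WeakPartialQuotients.
Variable A : eqType.
Variables (a : nat -> A) (K : nat).

Lemma flatten_mkseqS (T : Type) (f : nat -> seq T) n :
  flatten (mkseq f n.+1) = flatten (mkseq f n) ++ f n.
Proof. by rewrite /mkseq -addn1 iotaD map_cat flatten_cat /= cats0. Qed.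

Lemma wpq_run_bound k : weak_partial_quotients a k -> (forall n, k n <= K) ->
  run_bound a K.
Proof.
move=> [b [nb k1 hlim]] kK.
pose F n := flatten (mkseq (fun m => nseq (k m) (b m)) n).
have FS n : F n.+1 = F n ++ nseq (k n) (b n) by apply: flatten_mkseqS.
have Fpre n n' : n <= n' -> exists t, F n' = F n ++ t.
  elim: n' => [|n' IH]; first by case: n => // _; exists [::]; rewrite cats0.
  rewrite leq_eqVlt => /predU1P[->|/IH[t e]]; first by exists [::]; rewrite cats0.
  by exists (t ++ nseq (k n') (b n')); rewrite FS e catA.
have occF n : occ a 0 (F n).
  have [N hN] := hlim (size (F n)).
  have [t e] := Fpre n (maxn n N) (leq_maxl _ _).
  have := hN _ (leq_maxr n N); rewrite -/(F _) e => /prefixP[s].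
  by move=> /(congr1 (take (size (F n)))); rewrite !take_size_cat ?size_mkseq.
have szF n : n <= size (F n).
  by elim: n => // n IH; rewrite FS size_cat size_nseq; have := k1 n; lia.
move=> n; have hex : exists j, n < size (F j) by exists n.+1; apply: szF.
(* Position [n] lies in block [j]; the next block has another letter and starts at most [k j]
   later. *)
case: (ex_minnP hex) => -[//|j] hj jmin.
have le : size (F j) <= n.
  by rewrite leqNgt; apply/negP => /jmin; rewrite ltnn.
have := occF j.+2; rewrite FS occ_cat FS occ_cat !size_cat !size_nseq add0n.
move=> [[_ o1] o2]; rewrite FS size_cat size_nseq in hj.
exists (size (F j) + k j - n); first by have := kK j; lia.
have -> : n + (size (F j) + k j - n) = size (F j) + k j + 0 by lia.
rewrite (occ_nth (b j) o2) ?size_nseq ?k1 // nth_nseq k1.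
have -> : n = size (F j) + (n - size (F j)) by lia.
rewrite (occ_nth (b j) o1) ?size_nseq; last by lia.
rewrite nth_nseq; case: ltnP => [_ e|]; last by lia.
by have := nb j; rewrite e eqxx.
Qed.

Lemma run_bound_wpq : run_bound a K ->
  exists k, weak_partial_quotients a k /\ forall n, k n <= K.
Proof.
move=> hK.
have hex p : exists i, [/\ i <= K, a (p + i) <> a p & forall t, t < i -> a (p + t) = a p].
  have [i0 iK ni] := hK p.
  have ex : exists i, a (p + i) != a p by exists i0; apply/eqP.
  case: (ex_minnP ex) => i /eqP hi imin; exists i; split => //.
    by apply: leq_trans iK; apply: imin; apply/eqP.
  by move=> t; rewrite ltnNge => h; apply/eqP; apply: contraNT h; apply: imin.
have [len hlen] := choice hex.
pose S := fix S n := if n is m.+1 then S m + len (S m) else 0.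
pose k n := len (S n); pose b n := a (S n).
exists k; split; last by move=> n; have [] := hlen (S n).
exists b; split => [n|n|m].
- by have [_ h _] := hlen (S n); apply/eqP => e; apply: h; rewrite /b /= in e *.
- by rewrite lt0n; apply/eqP => e; have [_ h _] := hlen (S n); apply: h; rewrite -/(k n) e addn0.
pose F n := flatten (mkseq (fun m => nseq (k m) (b m)) n).
have FE n : F n = mkseq a (S n).
  elim: n => [//|n IH]; rewrite /F flatten_mkseqS -/(F n) IH /= /mkseq iotaD map_cat.
  have -> : iota (0 + S n) (len (S n)) = map (addn (S n)) (iota 0 (len (S n))).
    by rewrite -iotaDl addn0.
  congr cat; rewrite -map_comp -/(k n).
  have [_ _ h] := hlen (S n).
  apply: (@eq_from_nth _ (b n)) => [|i]; rewrite size_nseq ?size_map ?size_iota // => ik.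
  by rewrite nth_nseq ik (nth_map 0) ?size_iota // nth_iota //= add0n h.
have Sge n : n <= S n.
  elim: n => // n IH /=; have [_ h _] := hlen (S n).
  suff : 0 < len (S n) by lia.
  by rewrite lt0n; apply/eqP => e; apply: h; rewrite e addn0.
exists m => n mn; rewrite -/(F n) FE.
have le : m <= S n := leq_trans mn (Sge n).
by rewrite /mkseq -(subnKC le) iotaD map_cat prefix_prefix.
Qed.

End WeakPartialQuotients.

(** * Directive sequences of Arnoux-Rauzy languages *)

Section Languages.
Variable A : finType.
Hypothesis card_A : 1 < #|A|.
Implicit Types (L : seq A -> Prop) (a b : A).

Definition factorial_lang L := forall u v w, L (u ++ v ++ w) -> L v.
Definition irreducible_lang L :=
  forall u v, L u -> L v -> exists w, L (u ++ w ++ v).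
Definition right_extendable L := forall w, L w -> exists b, L (rcons w b).
Definition rspecial L w := exists b e, [/\ b <> e, L (rcons w b) & L (rcons w e)].
(** In a factorial language, uniqueness makes the right special words suffixes of one another. *)
Definition rspecial_chain L :=
  (forall n, exists w, size w = n /\ forall b, L (rcons w b)) /\
  (forall w w', size w = size w' -> rspecial L w -> rspecial L w' -> w = w').
Definition mirror L w := L (rev w).
(** The desubstituted language. The [a] in front makes the operation commute with [mirror]. *)
Definition descent a L w := L (a :: ar_subst a w).
Definition separating a L := forall b e, L [:: b; e] -> b = a \/ e = a.

Definition ar_lang L :=
  [/\ factorial_lang L, irreducible_lang L,
      rspecial_chain L & rspecial_chain (mirror L)].

Lemma other_letter a : exists b, b != a.
Proof.
have /card_gt1P[b [e [_ _ be]]] := card_A.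
by have [<-|h] := eqVneq b a; [exists e; rewrite eq_sym|exists b].
Qed.

Lemma factorial_prefix L u v : factorial_lang L -> L (u ++ v) -> L u.
Proof. by move=> hf; apply: (hf [::]). Qed.

Lemma factorial_suffix L u v : factorial_lang L -> L (u ++ v) -> L v.
Proof. by move=> hf; rewrite -[v in X in X -> _]cats0; apply: hf. Qed.

Lemma factorial_mirror L : factorial_lang L -> factorial_lang (mirror L).
Proof. by move=> hf u v w; rewrite /mirror !rev_cat -catA; apply: hf. Qed.

Lemma irreducible_extendable L : factorial_lang L -> irreducible_lang L ->
  (forall b, L [:: b]) -> right_extendable L.
Proof.
move=> hf hi hl w Lw; have [b _] := other_letter (enum_val (Ordinal card_A)).
have [u] := hi _ _ Lw (hl b); case: u => [|e u] h; first by exists b; rewrite -cats1.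
by exists e; rewrite -cats1; apply: (@factorial_prefix _ _ (u ++ [:: b])) => //; rewrite -catA.
Qed.

Lemma irreducible_mirror L : irreducible_lang L -> irreducible_lang (mirror L).
Proof.
move=> hi u v Lu Lv; have [w h] := hi _ _ Lv Lu; exists (rev w).
by rewrite /mirror !rev_cat revK -catA.
Qed.

Lemma separating_mirror a L : separating a L -> separating a (mirror L).
Proof. by move=> h b e /h []; [right|left]. Qed.

Lemma mirror_descent a L : mirror (descent a L) = descent a (mirror L).
Proof. by apply/funext => w; rewrite /mirror /descent rev_cons_ar_subst. Qed.

Lemma separating_valid a L w : factorial_lang L -> separating a L -> L w -> valid a w.
Proof.
move=> hf hs; elim/(@desub_ind _ a): w => [|r IH|b nb|b e r nb IH] //= Lw.
- by rewrite eqxx; apply: IH; apply: (@factorial_suffix _ [:: a]).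
- by rewrite (negbTE nb).
rewrite (negbTE nb); apply/andP; split.
  by have [h|->//] := hs b e (@factorial_prefix _ [:: b; e] r hf Lw); rewrite h eqxx in nb.
by apply: IH; apply: (@factorial_suffix _ [:: b; e]).
Qed.

Lemma factorial_descent a L : factorial_lang L -> factorial_lang (descent a L).
Proof.
move=> hf u v w; rewrite /descent !ar_subst_cat -cat_cons.
have [t ->] := cons_ar_subst a u.
by rewrite -cats1 -catA -[[:: a] ++ _]/((a :: ar_subst a v) ++ ar_subst a w); apply: hf.
Qed.

(** A letter [b] other than [a] is always followed by [a], so its whole image comes with it. *)
Lemma descent_rcons a L w b : factorial_lang L -> separating a L -> right_extendable L ->
  descent a L (rcons w b) <-> L (rcons (a :: ar_subst a w) b).
Proof.
move=> hf hs he; have e0 : ar_subst a [:: b] = if b == a then [:: a] else [:: b; a].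
  by rewrite /ar_subst /= cats0.
rewrite /descent -!cats1 ar_subst_cat -cat_cons e0.
have [->|nb] := eqVneq b a; first by [].
split=> [|h].
  by move=> h; apply: (@factorial_prefix _ _ [:: a] hf); rewrite -catA.
have [e] := he _ h; rewrite -cats1 -catA => h'.
have [eb|ea] : b = a \/ e = a by apply: hs; apply: (factorial_suffix hf h').
  by rewrite eb eqxx in nb.
by rewrite ea in h'.
Qed.

Lemma rspecial_chain_descent a L :
  factorial_lang L -> separating a L -> right_extendable L ->
  rspecial_chain L -> rspecial_chain (descent a L).
Proof.
move=> hf hs he [hex huniq]; split=> [n|w1 w2 sz [b1 [e1 [n1 l1 l1']]] [b2 [e2 [n2 l2 l2']]]].
  (* At most two letters are spent up to the first [a], and [desub] at worst halves the length. *)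
  have [W [sW hW]] := hex n.*2.+2.
  have lastW : last a W = a.
    have [b nb] := other_letter a.
    case: (lastP W) (hW b) => [//|V e]; rewrite last_rcons -!cats1 -catA => h.
    by have [//|eb] := hs e b (factorial_suffix hf h); rewrite eb eqxx in nb.
  have [U [V [eW sV]]] : exists U V, W = U ++ a :: V /\ n.*2 <= size V.
    case: W sW hW {lastW} => [//|e [//|f V]] /= sW hW.
    have [eq|eq] : e = a \/ f = a.
      by apply: (hs e f); apply: (@factorial_prefix _ _ (rcons V a)) => //; apply: (hW a).
      by exists [::], (f :: V); rewrite eq; split => //=; lia.
    by exists [:: e], V; rewrite eq; split => //; lia.
  have LV b : L (rcons (a :: V) b).
    by apply: (@factorial_suffix _ U) => //; rewrite -rcons_cat -eW.
  have vV : valid a V.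
    apply: (separating_valid hf hs); apply: (hf [:: a] V [:: a]).
    by rewrite cats1; apply: (LV a).
  have eV : ar_subst a (desub a V) = V.
    have lV : last a V = a by rewrite -[RHS]lastW eW last_cat.
    by rewrite subst_desub // lV eqxx.
  exists (drop (size (desub a V) - n) (desub a V)); split.
    rewrite size_drop subKn // -leq_double.
    by apply: leq_trans sV _; apply: size_desub_ge.
  move=> b; apply: (@factorial_suffix _ (take (size (desub a V) - n) (desub a V))).
    exact: factorial_descent.
  by rewrite -rcons_cat cat_take_drop descent_rcons // eV.
(* The words [a :: ar_subst a w1] and [a :: ar_subst a w2] are right special in [L], so one is a
   suffix of the other. The part in front desubstitutes as well, and equal sizes leave no room for
   it. *)
wlog le : w1 w2 sz b1 e1 n1 l1 l1' b2 e2 n2 l2 l2' /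
    size (ar_subst a w1) <= size (ar_subst a w2).
  move=> H; have [le|/ltnW le] := leqP (size (ar_subst a w1)) (size (ar_subst a w2)).
    exact: (H w1 w2 sz b1 e1 n1 l1 l1' b2 e2 n2 l2 l2' le).
  exact/esym/(H w2 w1 (esym sz) b2 e2 n2 l2 l2' b1 e1 n1 l1 l1' le).
move: l1 l1' l2 l2'; rewrite !descent_rcons // => l1 l1' l2 l2'.
set W2 := a :: ar_subst a w2 in l2 l2'.
pose k := size W2 - size (a :: ar_subst a w1).
have eW : drop k W2 = a :: ar_subst a w1.
  apply: huniq; first by rewrite size_drop /k subKn.
    exists b2, e2; split => //; apply: (@factorial_suffix _ (take k W2)) => //;
    by rewrite -rcons_cat cat_take_drop.
  by exists b1, e1.
have := cat_take_drop k W2; rewrite eW /W2.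
case: (take k _) => [[/ar_subst_inj//]|f Z [ef]].
rewrite -cat_rcons => eZ.
have vZ : valid a (rcons Z a).
  apply: (separating_valid hf hs); apply: (hf [:: a] _ (ar_subst a w1 ++ [:: b2])).
  by rewrite (catA (rcons Z a)) eZ cats1.
have eZ' := subst_desub vZ; rewrite last_rcons eqxx in eZ'.
move: eZ; rewrite -eZ' -ar_subst_cat => /ar_subst_inj e.
by move: (sz); rewrite -e size_cat; case: (desub a _) => //= ? ?; lia.
Qed.

Lemma ar_lang_letters L b : ar_lang L -> L [:: b].
Proof. by move=> [_ _ [h _] _]; have [w [/size0nil ->]] := h 0; apply. Qed.

Lemma ar_lang_extendable L : ar_lang L -> right_extendable L.
Proof.
move=> hL; have [hf hi _ _] := hL; apply: irreducible_extendable => // b.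
exact: ar_lang_letters.
Qed.

Lemma ar_lang_mirror L : ar_lang L -> ar_lang (mirror L).
Proof.
move=> [h1 h2 h3 h4]; split => //; [exact: factorial_mirror|exact: irreducible_mirror|].
by have -> : mirror (mirror L) = L by apply/funext => w; rewrite /mirror revK.
Qed.

Lemma ar_lang_descent a L : ar_lang L -> separating a L -> ar_lang (descent a L).
Proof.
move=> hL hs; have [hf hi hr hm] := hL; split.
- exact: factorial_descent.
- move=> u v Lu Lv; have [w h] := hi _ _ Lu Lv.
  have hwa : ar_subst a (desub a (rcons w a)) = rcons w a.
    rewrite subst_desub ?last_rcons ?eqxx //.
    apply: (separating_valid hf hs); apply: (hf (a :: ar_subst a u) _ (ar_subst a v)).
    by rewrite cat_rcons.
  exists (desub a (rcons w a)).
  by rewrite /descent !ar_subst_cat hwa cat_rcons -cat_cons.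
- by apply: rspecial_chain_descent => //; apply: ar_lang_extendable.
rewrite mirror_descent; apply: rspecial_chain_descent => //.
- exact: factorial_mirror.
- exact: separating_mirror.
- exact/ar_lang_extendable/ar_lang_mirror.
Qed.

(* If the right special letter a and the left special letter a' differed, a'
   could only be followed by itself. *)
Lemma ar_lang_separating L : ar_lang L -> exists a, separating a L.
Proof.
move=> hL; have [hf hi hR hM] := hL.
have one L' : rspecial_chain L' -> exists a, forall b, L' [:: a; b].
  by move=> [h _]; have [w [sw hw]] := h 1; case: w sw hw => [|a [|? ?]] // _ hw; exists a.
have [a ha] := one _ hR; have [a' ha'] := one _ hM.
have foll b e : b <> a -> L [:: b; e] -> e = a'.
  move=> nb Lbe; apply: contrapT => ne.
  have Lba : L [:: b; a'] by have := ha' b.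
  have [] // : [:: b] = [:: a].
  apply: hR.2 => //; first by exists e, a'.
  by have [c nc] := other_letter a; exists a, c; split; [apply/nesym/eqP|apply: ha|apply: ha].
have aa' : a = a'.
  apply: contrapT => ne.
  have [w] := hi _ _ (ar_lang_letters a' hL) (ar_lang_letters a hL).
  elim: w => [|e w IH] /= h; first by apply/ne/(foll a') => // e; apply: ne.
  have ee : e = a'.
    apply: (foll a'); first by move=> e'; apply: ne.
    exact: (@factorial_prefix _ [:: a'; e] (w ++ [:: a]) hf).
  by apply: IH; rewrite -ee; apply: (@factorial_suffix _ [:: a']).
exists a => b e Lbe; have [->|/eqP nb] := eqVneq b a; first by left.
by right; rewrite aa'; apply: (foll b).
Qed.

Lemma ar_lang_directive L0 : ar_lang L0 -> exists (a : nat -> A) (L : nat -> seq A -> Prop),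
  L 0 = L0 /\ forall n, [/\ ar_lang (L n), separating (a n) (L n)
                           & L n.+1 = descent (a n) (L n)].
Proof.
move=> h0; have [b0 _] := other_letter (enum_val (Ordinal card_A)).
(* The implication lets [choice] give a letter for every language, with [b0] as the default. *)
have hex L : exists a, ar_lang L -> separating a L.
  have [/ar_lang_separating[a ha]|h] := pselect (ar_lang L); first by exists a.
  by exists b0.
have [f hf] := choice hex.
pose L := fix L n := if n is m.+1 then descent (f (L m)) (L m) else L0.
have hL n : ar_lang (L n).
  by elim: n => //= n IH; apply: ar_lang_descent => //; apply: hf.
by exists (fun n => f (L n)), L; split => // n; split => //; apply: hf.
Qed.

Section Directive.
Variables (a : nat -> A) (L : nat -> seq A -> Prop).
Hypothesis hL : forall n,
  [/\ ar_lang (L n), separating (a n) (L n) & L n.+1 = descent (a n) (L n)].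

Lemma extend_right_letter n w b :
  b != a n -> L n (rcons w b) -> L n (rcons (rcons w b) (a n)).
Proof.
move=> nb h; have [hA hs _] := hL n; have [hf _ _ _] := hA.
have [e h'] := ar_lang_extendable hA h.
have [eb|<-//] : b = a n \/ e = a n.
  by apply: hs; apply: (@factorial_suffix _ w) => //; move: h'; rewrite -!cats1 -catA.
by rewrite eb eqxx in nb.
Qed.

Lemma extend_left_letter n w b :
  b != a n -> L n (b :: w) -> L n [:: a n, b & w].
Proof.
move=> nb h; have [hA hs _] := hL n; have [hf _ _ _] := hA.
have [e] := @ar_lang_extendable _ (ar_lang_mirror hA) (rev (b :: w)) ltac:(by rewrite /mirror revK).
rewrite /mirror rev_rcons revK => h'.
have [<-//|eb] : e = a n \/ b = a n.
  by apply: hs; apply: (@factorial_prefix _ [:: e; b] w).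
by rewrite eb eqxx in nb.
Qed.

(** A letter other than [a n] at either end of [w] is bordered by [a n], so [w] extends to [a n]
    followed by full images. *)
Lemma directive_step n w : w <> [::] -> L n w ->
  valid (a n) w /\ L n.+1 (desub (a n) (strip (a n) w)).
Proof.
move=> w0 Lw; have [hA hs eS] := hL n; have [hf _ _ _] := hA.
split; first exact: separating_valid Lw.
have : L n (a n :: strip (a n) w).
  case: w w0 Lw => // b r _; rewrite /=; have [->//|nb] := eqVneq b (a n).
  exact: extend_left_letter.
move: (strip _ _) => v Lv; rewrite eS /descent.
have vv : valid (a n) v by apply: (separating_valid hf hs); apply: (@factorial_suffix _ [:: a n]).
rewrite subst_desub //; case: eqP => // ne.
case: (lastP v) ne Lv => [//|u e]; rewrite last_rcons => /eqP ne Lv.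
by have := @extend_right_letter n (a n :: u) e ne Lv.
Qed.

Lemma directive_lang w m z : reduces a 0 w m z -> L 0 w.
Proof.
apply: reduces_lang => [n|n u v v'|n v].
- have [[hf _ [h _] _] _ _] := hL n; have [v [/size0nil -> hv]] := h 0.
  by apply: (@factorial_prefix _ [::] [:: a n] hf (hv (a n))).
- by have [[hf _ _ _] _ _] := hL n; apply: hf.
by have [_ _ ->] := hL n.
Qed.

(* A return b w b to a letter b which is no longer used would get shorter and
   shorter. *)
Lemma directive_inf b n : exists2 m, n <= m & a m = b.
Proof.
apply: contrapT => hno.
have nb m : n <= m -> b != a m by move=> nm; apply/eqP => e; apply: hno; exists m.
have {hno} : exists w, L n (b :: rcons w b).
  have [hA _ _] := hL n; have [_ hi _ _] := hA.
  have [w h] := hi _ _ (ar_lang_letters b hA) (ar_lang_letters b hA).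
  by exists w; rewrite -cats1.
case=> w; have [s] := ubnP (size w); elim: s n w nb => // s IH n w nb sz Lw.
have nbn := nb n (leqnn n); have [hA hs eS] := hL n; have [hf _ _ _] := hA.
have vw : valid (a n) (b :: w).
  by apply: (separating_valid hf hs); apply: (@factorial_prefix _ _ [:: b] hf); rewrite cats1.
(* The letter before the second [b] must be [a n], so [b :: w] consists of whole images. *)
have ew : ar_subst (a n) (desub (a n) (b :: w)) = b :: w.
  rewrite subst_desub //; case: eqP => //= nl.
  have [h|h] : last b w = a n \/ b = a n.
  - apply: hs; apply: (@factorial_suffix _ (belast b w)) => //.
    by move: Lw; rewrite -rcons_cons lastI -!cats1 -catA.
  - by rewrite h in nl.
  - by rewrite h eqxx in nbn.
have Lw' : L n [:: a n, b & rcons (rcons w b) (a n)].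
  by apply: extend_left_letter => //; apply: (@extend_right_letter n (b :: w)).
move: vw ew; rewrite [desub _ _]/= (negbTE nbn); case: w sz Lw Lw' => [|e w] sz Lw Lw' vw ew.
  by move: ew; rewrite /ar_subst /= (negbTE nbn).
apply: (IH n.+1 (desub (a n) w)) => [m nm||]; first by apply: nb; lia.
  by have := size_desub (a n) w; move: sz => /=; lia.
rewrite eS /descent -cats1 -cat_cons ar_subst_cat ew /ar_subst /= (negbTE nbn).
by move: Lw'; rewrite -!cats1 -catA.
Qed.

End Directive.
End Languages.

(** * Special words and factor complexity *)

Section Complexity.
Variable A : finType.

(** Every word but the right special one has at most one right extension. Passing from length [n] to
    [n + 1] adds [#|A| - 1] words, so the right special word must have all [#|A|] extensions. *)
Lemma rspecial_chain_complexity (L : seq A -> Prop) :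
  (forall u v, L (u ++ v) -> L u) ->
  (forall n, #|[set w : n.-tuple A | `[< L w >]]| = (#|A| - 1) * n + 1) ->
  (forall n, exists! w, size w = n /\ rspecial L w) ->
  rspecial_chain L.
Proof.
move=> hp hc hu; split; last first.
  move=> w w' sz hw hw'; have [v [_ hv]] := hu (size w).
  by rewrite -(hv w) // -(hv w').
move=> n; have [w [[sw [b [e [be Lb Le]]]] huw]] := hu n; exists w; split => //.
pose ext (v : n.-tuple A) := [set b | `[< L (rcons v b) >]].
pose W := in_tuple w; pose w0 : n.-tuple A := tcast sw W.
have ew0 : tval w0 = w by rewrite val_tcast.
have LW : L w by apply: (hp _ [:: b]); rewrite cats1.
have ext1 v : v != w0 -> #|ext v| <= `[< L v >].
  move=> nv; rewrite leqNgt; apply/negP => lt.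
  have [] : exists b1 b2, [/\ b1 \in ext v, b2 \in ext v & b1 != b2] \/ (L (rcons v b1) /\ ~ L v).
    case: asboolP lt => [_ /card_gt1P[b1 [b2 h]]|nL /card_gt0P[b1]].
      by exists b1, b2; left.
    by rewrite inE => /asboolP h; exists b1, b1; right.
  move=> b1 [b2 [[]|[h []]]]; last by apply: (hp _ [:: b1]); rewrite cats1.
  rewrite !inE => /asboolP h1 /asboolP h2 /eqP ne.
  case/eqP: nv; apply: val_inj; rewrite /= ew0; apply/esym/huw; split; first exact: size_tuple.
  by exists b1, b2.
have cardS : (#|A| - 1) * n.+1 + 1 <= \sum_(v : n.-tuple A) #|ext v|.
  rewrite -(hc n.+1).
  pose P := [set p : n.-tuple A * A | `[< L (rcons p.1 p.2) >]].
  have -> : \sum_v #|ext v| = #|P|.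
    rewrite -sum1_card (eq_bigl (fun p => true && (p.2 \in ext p.1))); last by move=> p; rewrite !inE.
    rewrite -(pair_big_dep xpredT (fun v b => b \in ext v) (fun _ _ => 1)) /=.
    by apply: eq_bigr => v _; rewrite sum1_card.
  pose g (p : n.-tuple A * A) : n.+1.-tuple A := [tuple of rcons p.1 p.2].
  apply: leq_trans (leq_imset_card g P); apply: subset_leq_card.
  apply/fintype.subsetP => u; rewrite inE => /asboolP Lu.
  have eu : tval u = rcons (belast (thead u) (behead u)) (last (thead u) (behead u)).
    by rewrite -lastI [in LHS](tuple_eta u).
  have sz : size (belast (thead u) (behead u)) == n.
    by rewrite size_belast size_behead size_tuple.
  apply/imsetP; exists (Tuple sz, last (thead u) (behead u)).
    by rewrite inE /= -eu; apply/asboolP.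
  by apply: val_inj; rewrite /= -eu.
have cardn : \sum_(v : n.-tuple A | v != w0) #|ext v| <= (#|A| - 1) * n.
  apply: (@leq_trans (\sum_(v : n.-tuple A | v != w0) `[< L v >])); first exact: leq_sum.
  have := hc n; rewrite -sum1_card (bigD1 w0) /=; last by rewrite inE ew0; apply/asboolP.
  rewrite addnC => /addIn <-.
  rewrite big_mkcond [leqRHS]big_mkcond /=; apply: leq_sum => v _.
  by rewrite inE; case: asboolP => _; case: (v != w0).
have full : #|A| <= #|ext w0|.
  move: cardS; rewrite (bigD1 w0) //= mulnSr.
  have : 0 < #|A| by apply/card_gt0P; exists b.
  move: cardn; set s := \sum_(i | _) _; move: (_ * n) => t.
  by lia.
have /eqP extT : ext w0 == [set: A].
  by rewrite eqEcard finset.subsetT cardsT.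
move=> b1; have : b1 \in ext w0 by rewrite extT inE.
by rewrite inE ew0 => /asboolP.
Qed.

Lemma arnoux_rauzy_lang (x : nat -> A) : arnoux_rauzy x -> ar_lang (factor x).
Proof.
move=> [hrec hc hl hr].
have hf : factorial_lang (factor x).
  by move=> u v w [i /occ_cat[_ /occ_cat[o _]]]; exists (i + size u).
split => //.
- move=> u v [i ou] fv; have [j ij oj] := hrec v fv (i + size u).
  exists (window x (i + size u) (j - (i + size u))), i; apply/occ_cat; split => //.
  apply/occ_cat; split; first exact: occ_window.
  by rewrite size_window subnKC.
- by apply: rspecial_chain_complexity => // u v; apply: (hf [::]).
apply: rspecial_chain_complexity => [u v|n|n].
- by rewrite /mirror rev_cat => h; apply: (factorial_suffix hf h).
- rewrite -(hc n); pose g (w : n.-tuple A) : n.-tuple A := [tuple of rev w].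
  have gK : involutive g by move=> w; apply: val_inj; rewrite /= revK.
  rewrite -(card_imset _ (inv_inj gK)); apply: eq_card => w.
  by rewrite -{1}[w]gK mem_imset ?inE /mirror /= ?revK //; apply: inv_inj.
have [w [[sw [b [e [be fb fe]]]] hw]] := hl n; exists (rev w); split.
  rewrite size_rev; split => //; exists b, e.
  by rewrite /mirror !rev_rcons revK.
move=> w' [sw' [b' [e' [be' fb' fe']]]]; apply: (canLR revK); apply: hw.
rewrite size_rev; split => //; exists b', e'.
by move: fb' fe'; rewrite /mirror !rev_rcons.
Qed.

End Complexity.

(** * Uniform factor-balance and bounded weak partial quotients *)

Lemma uniformly_factor_balanced_ext (A : eqType) (x y : nat -> A) :
  (forall w, factor x w <-> factor y w) ->
  uniformly_factor_balanced x -> uniformly_factor_balanced y.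
Proof. by move=> h [B B0 hB]; exists B => // w u v /h hu /h hv; apply: hB. Qed.

Theorem theorem1p4 (A : finType) (hA : 2 <= #|A| <= 3) (x : nat -> A)
    (hx : arnoux_rauzy x) :
  uniformly_factor_balanced x <-> bounded_weak_partial_quotients x.
Proof.
have /andP[card2 _] := hA; split; last first.
  move=> [a [k [[ainf [c [y [hlim hfac]]]] hw [K kK]]]].
  have hK := wpq_run_bound hw kK.
  have [c' cc'] := other_letter card2 c.
  have [Y hY] := limit_word_exists cc' ainf.
  have ey : y = Y 0 by apply/funext/(word_lim_unique hY).
  apply: (@uniformly_factor_balanced_ext _ (Y 0)); first by move=> w; rewrite hfac ey.
  exact: (run_bound_balanced cc' ainf hY hA hK).
have hxL := arnoux_rauzy_lang hx.
have [a [L [L0 hL]]] := ar_lang_directive card2 hxL.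
have ainf := directive_inf card2 hL.
have /card_gt0P[c _] : 0 < #|A| by apply: ltnW.
have [c' cc'] := other_letter card2 c.
have [Y hY] := limit_word_exists cc' ainf.
(* Both languages consist of the words that reduce to the empty word along [a]. *)
have hfac w : factor x w <-> factor (Y 0) w.
  rewrite (factor_reduces cc' ainf hY) -L0; split.
    by apply: (reducesP ainf) => n v; apply: (directive_step card2 hL).
  by move=> [m [z]]; apply: (directive_lang hL).
move=> /(uniformly_factor_balanced_ext hfac)[B _ hB].
have hK := balanced_run_bound cc' ainf hY hB.
have [k [hw kK]] := run_bound_wpq hK.
exists a, k; split => //; last by exists (B.+3).*2.
split; first exact: ainf.
by exists c, (Y 0); split; first exact: (limit_word_lim cc' ainf hY).
Qed.
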